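(* For every $\varepsilon>0$ there exists a constant $C(\varepsilon)>0$ such that for every integer $q>1$ and every primitive quadratic Dirichlet character $\chi$ modulo $q$, $$L(1,\chi)>C(\varepsilon)\,q^{-\varepsilon}.$$
   Context: $L(s,\chi)$ denotes the Dirichlet L-function of $\chi$. A quadratic character is a Dirichlet character of order $2$ (real-valued and nonprincipal). The constant $C(\varepsilon)$ depends only on $\varepsilon$ and is not required to be effectively computable. *)

(* Defs.v *)
From HB Require Import structures.
From mathcomp Require Import all_boot all_order all_algebra complex.
From mathcomp Require Import all_classical all_reals all_analysis.

Set Implicit Arguments.
Unset Strict Implicit.
Unset Printing Implicit Defensive.

Import Order.TTheory GRing.Theory Num.Theory numFieldNormedType.Exports.
Local Open Scope ring_scope.
Local Open Scope complex_scope.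

(* A character of (Z/qZ)^* extended by zero to Z.  The value 1 at 1 follows
   from multiplicativity and the support condition. *)
Record dirichlet_char (R : realType) (q : nat) := DirichletChar {
  dchar_val :> int -> R[i];
  dchar_periodic : forall n : int, dchar_val (n + q%:Z) = dchar_val n;
  dcharM : forall m n : int, dchar_val (m * n) = dchar_val m * dchar_val n;
  dchar_supp : forall n : int, (dchar_val n != 0) = coprimez n q%:Z
}.

Definition principal_dchar (R : realType) (q : nat) (n : int) : R[i] :=
  (coprimez n q%:Z)%:R.

(* The order of chi in the group of characters modulo q. *)
Definition dchar_has_order (R : realType) (q : nat) (chi : dirichlet_char R q)
    (k : nat) : Prop :=
  [/\ (0 < k)%N,
      forall n : int, chi n ^+ k = principal_dchar R q n &
      forall j : nat, (0 < j < k)%N ->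
        ~ (forall n : int, chi n ^+ j = principal_dchar R q n)].

Definition quadratic_dchar (R : realType) (q : nat) (chi : dirichlet_char R q)
  : Prop := dchar_has_order chi 2.

Definition induced_by (R : realType) (q d : nat) (chi : dirichlet_char R q)
    (psi : dirichlet_char R d) : Prop :=
  forall n : int, coprimez n q%:Z -> chi n = psi n.

Definition primitive_dchar (R : realType) (q : nat) (chi : dirichlet_char R q)
  : Prop :=
  forall (d : nat) (psi : dirichlet_char R d),
    (d %| q)%N -> (d < q)%N -> ~ induced_by chi psi.

Definition cexp (R : realType) (z : R[i]) : R[i] :=
  (expR (complex.Re z))%:C * (cos (complex.Im z) +i* sin (complex.Im z)).

(* n ^ (- s) for n >= 1, with the real logarithm of n. *)
Definition nat_cpowN (R : realType) (n : nat) (s : R[i]) : R[i] :=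
  cexp (- s * (ln (n%:R : R))%:C).

(* L(s, chi) as the sum of its Dirichlet series, in order of increasing n.  For
   chi nonprincipal the series converges on the half-plane Re s > 0 (only
   conditionally where Re s <= 1); no continuation beyond the region of
   convergence is intended.  The cast to R[i]^o selects the norm topology of the
   complex numbers. *)
Definition dirichlet_L (R : realType) (q : nat) (s : R[i])
    (chi : dirichlet_char R q) : R[i] :=
  limn ((fun N : nat =>
    \sum_(1 <= n < N.+1) chi n%:Z * nat_cpowN n s) : nat -> R[i]^o).

(* Main.v *)
Require Import Defs.
From HB Require Import structures.
From mathcomp Require Import all_boot all_order all_algebra complex.
From mathcomp Require Import all_classical all_reals all_analysis.
From mathcomp Require Import ring lra zify.
Import Order.TTheory GRing.Theory Num.Theory numFieldNormedType.Exports.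
Local Open Scope ring_scope.
Local Open Scope complex_scope.

(** Siegel's theorem holds because a real character whose L-function has a real
    zero very close to [1] prevents every other real character from having a
    small value [L(1, g)].  The argument below stays on the real line and uses
    neither continuation of L-functions nor contour integrals.

    For a real character [f], the product [zeta(s) L(s, f)] has nonnegative
    Dirichlet coefficients with first coefficient [1] ([rep_ge0], [rep1]); for
    two such characters the same is true of
    [zeta(s) L(s, f) L(s, g) L(s, f g)] ([rep_triple_ge0]).  Call [a n] these
    coefficients, and let [l] and [lam] be the values at [s] and at [1] of the
    product deprived of [zeta].  For [s < 1] close to [1] the hyperbola method
    ([rep_asymptotics]) gives

      [sum_(n <= x) a n / n ^ s = lam * x ^ (1 - s) / (1 - s) + zeta(s) * l
         + O (q ^ A * x ^ (- d))]

    with fixed [A], [d > 0] and [zeta(s) <= 0].  The left-hand side is at least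
    [1].  As soon as [l >= 0], taking for [x] a fixed power of [q] makes the error
    at most [1 / 2] and forces [lam >= c * q ^ (- B * (1 - s))]
    ([rep_lower_bound], [lower_bound_from_asymptotics]).

    Now fix a small [eta] ([siegel_family]).
    - If no L-function of the family vanishes on [1 - eta <= s < 1], then, since
      [L(1, f) > 0] ([Dsum1_gt0]), the intermediate value theorem yields
      [L(1 - eta, f) >= 0], and [zeta L(f)] with [s = 1 - eta] gives the bound
      ([Dsum1_lower_no_zero]).
    - Otherwise fix one [f] and [s] in this interval with [L(s, f) = 0].  For
      every other [g] the product of four factors has [l = 0], so that
      [L(1, f) L(1, g) L(1, f g)] is bounded below ([Dsum1_lower_zero]), and an
      upper bound for [L(1, f g)] ([Dsum1_le]) concludes.  The constant depends on
      the unknown [f]; this is the source of the ineffectiveness.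

    The power saving for [L(f) L(g) L(f g)] comes from the Dirichlet series of
    each factor, which converges at a power rate because character sums are
    bounded; each convolution halves the exponent, roughly, and keeps it positive
    ([controlled_dconv]).  The second case requires [f g] to be nonprincipal for
    distinct primitive [f] and [g] ([re_char_product]), which rests on the fact
    that a primitive character is not determined by residues modulo a number that
    its modulus does not divide ([conductor_dvd]). *)

Set Implicit Arguments.
Unset Strict Implicit.
Unset Printing Implicit Defensive.

(** * Partial sums and Dirichlet convolution *)

Section Arith.
Context {R : realType}.
Implicit Types f g h : nat -> R.

Definition psum f (N : nat) : R := \sum_(1 <= n < N.+1) f n.

Definition dconv f g (n : nat) : R :=
  \sum_(1 <= d < n.+1 | (d %| n)%N) f d * g (n %/ d)%N.

Lemma psum0 f : psum f 0 = 0. Proof. by rewrite /psum big_geq. Qed.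

Lemma psumS f N : psum f N.+1 = psum f N + f N.+1.
Proof. by rewrite /psum big_nat_recr. Qed.

Lemma eq_psum f g N : (forall n, (0 < n)%N -> f n = g n) -> psum f N = psum g N.
Proof.
by move=> fg; rewrite /psum; apply: eq_big_nat => n /andP[n0 _]; exact: fg.
Qed.

(** Identities between convolutions are read off from their partial sums, where
    they amount to exchanging two finite sums. *)
Lemma psum_inj f g : psum f =1 psum g -> forall n, (0 < n)%N -> f n = g n.
Proof.
move=> fg [//|n] _; have := fg n.+1; rewrite !psumS fg.
by move/addrI.
Qed.

Lemma psum_multiples d f N : (0 < d)%N ->
  \sum_(1 <= n < N.+1 | (d %| n)%N) f n = \sum_(1 <= m < (N %/ d).+1) f (d * m)%N.
Proof.
move=> d0; elim: N => [|N IH]; first by rewrite div0n !big_geq.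
rewrite big_mkcond big_nat_recr //= -big_mkcond IH /= divnS //.
case: ifP => dN; last by rewrite add0n addr0.
rewrite add1n [RHS]big_nat_recr //=; congr (_ + f _).
have := divnS N d0; rewrite dN add1n => <-.
by rewrite mulnC divnK.
Qed.

(** The weight [h] is what makes the formula iterable, for [dconvA]. *)
Lemma sum_dconv f g h N :
  psum (fun n => dconv f g n * h n) N =
  \sum_(1 <= d < N.+1) f d * psum (fun m => g m * h (d * m)%N) (N %/ d).
Proof.
rewrite /psum /dconv.
under eq_big_nat => n /andP[n0 nN].
  rewrite (big_nat_widen _ _ N.+1) ?ltnS // big_mkcond mulr_suml /=; over.
rewrite exchange_big /=; apply: eq_big_nat => d /andP[d0 dN].
rewrite mulr_sumr.
transitivity (\sum_(1 <= n < N.+1 | (d %| n)%N) f d * (g (n %/ d)%N * h n)).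
  rewrite [RHS]big_mkcond; apply: eq_big_nat => n /andP[n0 nN].
  case: (boolP (d %| n)%N) => dn /=; last by rewrite mul0r.
  by rewrite ltnS dvdn_leq //= mulrA.
rewrite psum_multiples //; apply: eq_big_nat => m _.
by rewrite mulKn.
Qed.

Lemma psum_dconv f g N :
  psum (dconv f g) N = \sum_(1 <= d < N.+1) f d * psum g (N %/ d).
Proof.
have := sum_dconv f g (fun=> 1) N.
rewrite (_ : psum _ N = psum (dconv f g) N) => [->|].
  by apply: eq_bigr => d _; congr (_ * _); apply: eq_psum => m _; rewrite mulr1.
by apply: eq_psum => n _; rewrite mulr1.
Qed.

Lemma psum_div g N d : (0 < d)%N ->
  psum g (N %/ d) = \sum_(1 <= m < N.+1 | (d * m <= N)%N) g m.
Proof.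
move=> d0; rewrite /psum (big_nat_widen _ _ N.+1); last first.
  by rewrite ltnS leq_div.
by apply: eq_bigl => m; rewrite ltnS leq_divRL // mulnC.
Qed.

Lemma dconvC f g n : (0 < n)%N -> dconv f g n = dconv g f n.
Proof.
apply: psum_inj => N; rewrite !psum_dconv.
transitivity (\sum_(1 <= d < N.+1) \sum_(1 <= m < N.+1)
    (if (d * m <= N)%N then f d * g m else 0)).
  apply: eq_big_nat => d /andP[d0 dN].
  by rewrite psum_div // -big_mkcond mulr_sumr.
rewrite exchange_big /=; apply: eq_big_nat => d /andP[d0 dN].
rewrite psum_div // -big_mkcond mulr_sumr.
by apply: eq_big => m; rewrite mulnC // mulrC.
Qed.

(** Both sides have the partial sums [sum f d * g m * psum h (N %/ (d * m))]. *)
Lemma dconvA f g h n : (0 < n)%N ->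
  dconv f (dconv g h) n = dconv (dconv f g) h n.
Proof.
apply: psum_inj => N; rewrite !psum_dconv.
rewrite -[RHS]/(psum (fun d => dconv f g d * psum h (N %/ d)) N) sum_dconv.
apply: eq_big_nat => d /andP[d0 dN]; congr (_ * _); rewrite psum_dconv.
by apply: eq_bigr => m _; rewrite divnMA.
Qed.

Lemma eq_dconvr f g h n : (0 < n)%N ->
  (forall m, (0 < m)%N -> g m = h m) -> dconv f g n = dconv f h n.
Proof.
move=> n0 gh; rewrite /dconv big_nat_cond [RHS]big_nat_cond.
apply: eq_bigr => d /andP[/andP[d0 dn] ddn].
by rewrite gh // divn_gt0 // -ltnS.
Qed.

(** Dirichlet's hyperbola method: the pairs [(d, m)] with [d * m <= N] are those
    with [d <= u], together with those with [m <= u], and the pairs counted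
    twice fill the square of side [u]. *)
Lemma hyperbola f g N u : (u ^ 2 <= N)%N -> (N < u.+1 ^ 2)%N ->
  psum (dconv f g) N =
    psum (fun d => f d * psum g (N %/ d)) u +
    psum (fun m => g m * psum f (N %/ m)) u - psum f u * psum g u.
Proof.
move=> uN Nu.
have ulN : (u <= N)%N by move: uN; rewrite expnS expn1; nia.
rewrite psum_dconv (big_cat_nat _ (n := u.+1)) //= -addrA; congr (_ + _).
transitivity (\sum_(u.+1 <= d < N.+1) \sum_(1 <= m < u.+1)
    (if (d * m <= N)%N then f d * g m else 0)).
  apply: eq_big_nat => d /andP[ud dN].
  have d0 : (0 < d)%N by apply: leq_trans ud.
  rewrite -big_mkcond -mulr_sumr; congr (_ * _).
  rewrite /psum (big_nat_widen _ _ u.+1).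
    by apply: eq_bigl => m; rewrite ltnS leq_divRL // mulnC.
  rewrite ltnS -ltnS ltn_divLR //.
  by apply: leq_trans Nu _; rewrite expnS expn1 leq_mul2l ud orbT.
rewrite exchange_big /=.
rewrite /psum mulrC mulr_suml -sumrB.
apply: eq_big_nat => m /andP[m0 mu]; rewrite -mulrBr.
rewrite [in RHS](big_cat_nat _ (n := u.+1)) //=; last first.
  rewrite ltnS leq_divRL //; apply: leq_trans uN.
  by rewrite expnS expn1 leq_mul2l -ltnS mu orbT.
rewrite addrAC subrr add0r mulr_sumr [RHS](big_nat_widen _ _ N.+1) ?ltnS ?leq_div //.
rewrite -big_mkcond; apply: eq_big => d; last by rewrite mulrC.
by rewrite ltnS leq_divRL.
Qed.
End Arith.

(** * Multiplicative functions *)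

Section Multiplicative.
Context {R : realType}.
Implicit Types f g h : nat -> R.

Definition multiplicative f :=
  f 1%N = 1 /\
  forall m n, (0 < m)%N -> (0 < n)%N -> coprime m n -> f (m * n)%N = f m * f n.

Lemma dconv_divisors f g n : (0 < n)%N ->
  dconv f g n = \sum_(d <- divisors n) f d * g (n %/ d)%N.
Proof.
move=> n0; rewrite /dconv -big_filter; apply: perm_big; apply: uniq_perm.
- by rewrite filter_uniq // iota_uniq.
- exact: divisors_uniq.
- move=> d; rewrite mem_filter mem_index_iota -dvdn_divisors // ltnS.
  by case: (boolP (d %| n)%N) => //= dn; rewrite (dvdn_gt0 n0 dn) dvdn_leq.
Qed.

Lemma dconv1 f g : dconv f g 1 = f 1%N * g 1%N.
Proof. by rewrite dconv_divisors // /divisors /= big_seq1. Qed.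

(** A divisor [x] of [m * n] splits as [gcdn x m] times a divisor of [n]. *)
Lemma divisors_coprimeM m n : (0 < m)%N -> (0 < n)%N -> coprime m n ->
  perm_eq (divisors (m * n)) [seq (d * e)%N | d <- divisors m, e <- divisors n].
Proof.
move=> m0 n0 cmn.
have split d e : (d %| m)%N -> (e %| n)%N ->
    gcdn m (d * e) = d /\ gcdn n (d * e) = e.
  move=> dm en; split.
    rewrite Gauss_gcdl ?(gcdn_idPr _) //.
    by rewrite (coprime_dvdr en).
  rewrite Gauss_gcdr ?(gcdn_idPr _) //.
  by rewrite coprime_sym (coprime_dvdl dm).
apply: uniq_perm; first exact: divisors_uniq.
  apply: allpairs_uniq; try exact: divisors_uniq.
  move=> [d e] [d' e'] /allpairsP[[a b] /= [+ + [-> ->]]].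
  rewrite -!dvdn_divisors // => am bn.
  move=> /allpairsP[[a' b'] /= [+ + [-> ->]]].
  rewrite -!dvdn_divisors // => am' bn' E.
  have [A B] := split _ _ am bn; have [A' B'] := split _ _ am' bn'.
  by move: A B; rewrite (E : a * b = a' * b')%N A' B' => -> ->.
move=> x; rewrite -dvdn_divisors ?muln_gt0 ?m0 //.
apply/idP/allpairsP => [xmn|[[d e] /= []]]; last first.
  by rewrite -!dvdn_divisors // => dm en ->; exact: dvdn_mul.
have x0 : (0 < x)%N by apply: dvdn_gt0 xmn; rewrite muln_gt0 m0.
have g0 : (0 < gcdn x m)%N by rewrite gcdn_gt0 x0.
exists (gcdn x m, x %/ gcdn x m)%N; split => /=.
- by rewrite -dvdn_divisors // dvdn_gcdr.
- rewrite -dvdn_divisors //.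
  have cxm : coprime (x %/ gcdn x m) (m %/ gcdn x m).
    rewrite /coprime -(eqn_pmul2r g0) muln_gcdl !divnK ?dvdn_gcdl ?dvdn_gcdr //.
    by rewrite mul1n.
  rewrite -(Gauss_dvdr _ cxm) -(dvdn_pmul2r g0) mulnAC !divnK ?dvdn_gcdl //.
  by rewrite dvdn_gcdr.
- by rewrite mulnC divnK // dvdn_gcdl.
Qed.

Lemma multiplicative_dconv f g :
  multiplicative f -> multiplicative g -> multiplicative (dconv f g).
Proof.
move=> [f1 fM] [g1 gM]; split; first by rewrite dconv1 f1 g1 mulr1.
move=> m n m0 n0 cmn; rewrite !dconv_divisors ?muln_gt0 ?m0 //.
rewrite (perm_big _ (divisors_coprimeM m0 n0 cmn)) big_allpairs_dep /= mulr_suml.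
apply: eq_big_seq => d; rewrite -dvdn_divisors // => dm.
rewrite mulr_sumr; apply: eq_big_seq => e; rewrite -dvdn_divisors // => en.
have d0 := dvdn_gt0 m0 dm; have e0 := dvdn_gt0 n0 en.
rewrite fM //; last by rewrite (coprime_dvdl dm) // (coprime_dvdr en).
have -> : (m * n %/ (d * e) = (m %/ d) * (n %/ e))%N.
  by rewrite divnMA -divn_mulAC // muln_divA.
have md0 : (0 < m %/ d)%N by rewrite divn_gt0 // dvdn_leq.
have ne0 : (0 < n %/ e)%N by rewrite divn_gt0 // dvdn_leq.
have cmd : coprime (m %/ d) (n %/ e).
  exact: coprime_dvdl (dvdn_div dm) (coprime_dvdr (dvdn_div en) cmn).
by rewrite (gM _ _ md0 ne0 cmd) mulrACA.
Qed.

(** A property stable under products transfers from prime powers to all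
    integers; exponent [e = 2] is for statements about squares. *)
Lemma multiplicative_ind (P : R -> Prop) f e :
  multiplicative f -> P 1 -> (forall x y, P x -> P y -> P (x * y)) ->
  (forall p k, prime p -> P (f ((p ^ k) ^ e)%N)) ->
  forall n, (0 < n)%N -> P (f (n ^ e)%N).
Proof.
move=> [f1 fM] P1 PM Pp; elim/ltn_ind => n IH n0.
have [n1|n1] := leqP n 1.
  have -> : n = 1%N by apply/eqP; rewrite eqn_leq n1.
  by rewrite exp1n f1.
rewrite -(partnC (pdiv n) n0) expnMn fM ?expn_gt0 ?part_gt0 //; last first.
  by rewrite coprimeXl // coprimeXr // coprime_partC.
apply: PM; first by rewrite p_part; apply/Pp/pdiv_prime.
apply: IH; last exact: part_gt0.
rewrite -[X in (_ < X)%N](partnC (pdiv n) n0) ltn_Pmull ?part_gt0 //.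
rewrite p_part -[X in (X < _)%N](expn0 (pdiv n)) ltn_exp2l ?prime_gt1 ?pdiv_prime //.
by rewrite logn_gt0 mem_primes pdiv_prime //= n0 pdiv_dvd.
Qed.
End Multiplicative.

(** * Nonnegativity of the coefficients *)

Section SignCharacters.
Context {R : realType}.
Implicit Types f g h : nat -> R.

Definition one : nat -> R := fun=> 1.

Definition sign_hom f :=
  [/\ f 1%N = 1, {morph f : m n / (m * n)%N >-> m * n} &
      forall n, [\/ f n = -1, f n = 0 | f n = 1]].

Lemma sign_homM f g : sign_hom f -> sign_hom g ->
  sign_hom (fun n => f n * g n).
Proof.
move=> [f1 fM fv] [g1 gM gv]; split=> [|m n|n]; first by rewrite f1 g1 mulr1.
  by rewrite fM gM mulrACA.
case: (fv n) (gv n) => -> [] ->; rewrite ?mul0r ?mulr0 ?mulN1r ?opprK ?mul1r;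
  by [constructor 1|constructor 2|constructor 3].
Qed.

Lemma sign_hom_multiplicative f : sign_hom f -> multiplicative f.
Proof. by move=> [f1 fM _]; split=> // m n _ _ _; exact: fM. Qed.

Lemma multiplicative_one : multiplicative one.
Proof. by split=> // m n; rewrite mulr1. Qed.

Lemma sign_homX f n k : sign_hom f -> f (n ^ k)%N = f n ^+ k.
Proof.
move=> [f1 fM _]; elim: k => [|k IH]; first by rewrite expn0 expr0.
by rewrite expnS fM IH exprS.
Qed.

Lemma sign_hom_le1 f n : sign_hom f -> `|f n| <= 1.
Proof.
by move=> [_ _ /(_ n)[]->]; rewrite ?normrN ?normr1 ?normr0.
Qed.

Lemma dconv_primeX f g p k : prime p ->
  dconv f g (p ^ k)%N = \sum_(i < k.+1) f (p ^ i)%N * g (p ^ (k - i))%N.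
Proof.
move=> pp; have p0 := prime_gt0 pp.
rewrite dconv_divisors ?expn_gt0 ?p0 //.
rewrite (perm_big [seq (p ^ i)%N | i <- index_iota 0 k.+1]); last first.
  apply: uniq_perm; first exact: divisors_uniq.
    rewrite map_inj_uniq ?iota_uniq //.
    by move=> i j /eqP; rewrite eqn_exp2l ?prime_gt1 // => /eqP.
  move=> d; rewrite -dvdn_divisors ?expn_gt0 ?p0 //.
  apply/(dvdn_pfactor _ _ pp)/mapP => [[i ik ->]|[i + ->]].
    by exists i => //; rewrite mem_index_iota ltnS.
  by rewrite mem_index_iota ltnS => ik; exists i.
rewrite big_map big_mkord; apply: eq_bigr => i _.
by rewrite expnB // -ltnS.
Qed.

Lemma sum_signX (x : R) k : [\/ x = -1, x = 0 | x = 1] ->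
  if x == -1 then \sum_(i < k.+1) x ^+ i = (~~ odd k)%:R
  else 1 <= \sum_(i < k.+1) x ^+ i.
Proof.
move=> x3; case: eqP => [->|xN1].
  elim: k => [|k IH]; first by rewrite big_ord1.
  rewrite big_ord_recr /= IH -signr_odd /=.
  by case: (odd k); rewrite /= ?expr0 ?expr1 ?addrN ?add0r.
rewrite big_ord_recl expr0 lerDl sumr_ge0 // => i _; apply: exprn_ge0.
by case: x3 => // ->.
Qed.

(** The coefficients of [zeta(s) L(s, f)]. *)
Definition rep f := dconv one f.

Lemma rep_primeX f p k : sign_hom f -> prime p ->
  rep f (p ^ k)%N = \sum_(i < k.+1) f p ^+ i.
Proof.
move=> hf pp; rewrite /rep dconv_primeX //.
rewrite (reindex_inj rev_ord_inj) /=; apply: eq_bigr => i _.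
by rewrite mul1r subSS subKn ?sign_homX // -ltnS.
Qed.

Lemma multiplicative_rep f : sign_hom f -> multiplicative (rep f).
Proof.
move=> hf; apply: multiplicative_dconv multiplicative_one _.
exact: sign_hom_multiplicative.
Qed.

Lemma rep_ge0 f n : sign_hom f -> (0 < n)%N -> 0 <= rep f n.
Proof.
move=> hf n0; rewrite -(expn1 n).
apply: (multiplicative_ind (P := fun x => 0 <= x)) n0 => //.
- exact: multiplicative_rep.
- exact: mulr_ge0.
- move=> p k pp; rewrite expn1 rep_primeX //.
  have [_ _ fv] := hf.
  have := sum_signX k (fv p); case: ifP => _ => [->|]; first exact: ler0n.
  exact: le_trans.
Qed.

Lemma rep_sqr_ge1 f n : sign_hom f -> (0 < n)%N -> 1 <= rep f (n ^ 2)%N.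
Proof.
move=> hf n0.
apply: (multiplicative_ind (P := fun x => 1 <= x)) n0 => //.
- exact: multiplicative_rep.
- by move=> x y x1 y1; rewrite mulr_ege1.
- move=> p k pp; rewrite -expnM rep_primeX //.
  have [_ _ fv] := hf.
  have := sum_signX (k * 2)%N (fv p); case: ifP => _ => [->|//].
  by rewrite oddM andbF.
Qed.

(** The coefficients of [L(s, f) L(s, g) L(s, f g)]. *)
Definition triple f g := dconv (dconv f g) (fun n => f n * g n).

Lemma dconv_twist f g n : sign_hom f -> (0 < n)%N ->
  dconv f (fun n => g n * f n) n = f n * dconv g one n.
Proof.
move=> [_ fM _] n0; rewrite dconvC // !dconv_divisors // mulr_sumr.
apply: eq_big_seq => d; rewrite -dvdn_divisors // => dn.
by rewrite mulr1 -mulrA -fM mulnC divnK // mulrC.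
Qed.

(** Regrouped as [(zeta L(f)) (L(g) L(f g))], the product has for second factor
    the first one twisted by [g]. *)
Lemma rep_triple f g n : sign_hom f -> sign_hom g -> (0 < n)%N ->
  rep (triple f g) n = dconv (rep f) (fun n => g n * rep f n) n.
Proof.
move=> hf hg n0; rewrite /rep /triple.
transitivity (dconv one (dconv f (dconv g (fun n => f n * g n))) n).
  by apply: eq_dconvr => // m m0; rewrite dconvA.
rewrite dconvA //; apply: eq_dconvr => // m m0.
by rewrite dconv_twist // dconvC.
Qed.

Lemma rep_tripleC f g n : (0 < n)%N ->
  rep (triple f g) n = rep (triple g f) n.
Proof.
move=> n0; apply: eq_dconvr => // m m0; rewrite /triple.
rewrite dconvC // [RHS]dconvC //.
rewrite (_ : (fun n => f n * g n) = (fun n => g n * f n)).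
  by apply: eq_dconvr => // k k0; rewrite dconvC.
by apply/funext => k; rewrite mulrC.
Qed.

Lemma rep_triple_primeX_ge0 f g p k : sign_hom f -> sign_hom g -> prime p ->
  0 <= g p -> 0 <= rep (triple f g) (p ^ k)%N.
Proof.
move=> hf hg pp gp0; have p0 := prime_gt0 pp.
rewrite rep_triple ?expn_gt0 ?p0 // dconv_primeX //.
apply: sumr_ge0 => i _; rewrite !mulr_ge0 ?rep_ge0 ?expn_gt0 ?p0 //.
by rewrite sign_homX // exprn_ge0.
Qed.

(** Locally at a prime [p], the Euler factor of [zeta L(f) L(g) L(f g)] has
    nonnegative coefficients.  Writing the product as [(zeta L(f)) (L(g) L(f g))]
    settles it when [g p >= 0]; when [g p = -1] the roles of [f] and [g] are
    exchanged, because then [rep g] lives on the even powers of [p]. *)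
Lemma rep_triple_ge0 f g n : sign_hom f -> sign_hom g -> (0 < n)%N ->
  0 <= rep (triple f g) n.
Proof.
move=> hf hg n0; rewrite -(expn1 n).
apply: (multiplicative_ind (P := fun x => 0 <= x)) n0 => //.
- apply: multiplicative_dconv multiplicative_one _.
  apply: multiplicative_dconv; last exact/sign_hom_multiplicative/sign_homM.
  by apply: multiplicative_dconv; exact: sign_hom_multiplicative.
- exact: mulr_ge0.
- move=> p k pp; rewrite expn1; have p0 := prime_gt0 pp.
  have [_ _ gv] := hg.
  case: (gv p) => gp; try by rewrite rep_triple_primeX_ge0 // gp.
  (* only even powers of [p] carry [rep g], and there [f] is a square *)
  rewrite rep_tripleC ?expn_gt0 ?p0 // rep_triple ?expn_gt0 ?p0 //.
  rewrite dconv_primeX // sumr_ge0 // => i _.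
  rewrite !rep_primeX // sign_homX //.
  have := sum_signX i (gv p); have := sum_signX (k - i) (gv p).
  rewrite gp eqxx => -> ->; rewrite mulr_ge0 ?ler0n //.
  case: (boolP (odd (k - i))) => [_|ev]; first by rewrite mulr0.
  rewrite mulr1 -(odd_double_half (k - i)) (negbTE ev) add0n -mul2n exprM.
  by rewrite exprn_ge0 // sqr_ge0.
Qed.

Lemma rep_triple1 f g : sign_hom f -> sign_hom g -> rep (triple f g) 1 = 1.
Proof. by move=> [f1 _ _] [g1 _ _]; rewrite /rep /triple !dconv1 /one f1 g1 !mulr1. Qed.

Lemma rep1 f : sign_hom f -> rep f 1 = 1.
Proof. by move=> [f1 _ _]; rewrite /rep dconv1 /one f1 mulr1. Qed.
End SignCharacters.

(** * Dirichlet series of sequences with bounded sums *)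

Section Series.
Local Open Scope classical_set_scope.
Context {R : realType}.
Implicit Types (f : nat -> R) (s p x y : R).

Lemma ler_powRN s x y : 0 < x -> x <= y -> 0 <= s -> y `^ (- s) <= x `^ (- s).
Proof.
move=> x0 xy s0; rewrite !powRN lef_pV2 ?posrE ?powR_gt0 ?(lt_le_trans x0) //.
by rewrite ge0_ler_powR ?nnegrE ?(ltW x0) // (le_trans (ltW x0)).
Qed.

(** Weighted AM-GM: the graph of the concave function [t ^ p] lies below its
    tangent at [t = x]. *)
Lemma powR_tangent p x y : 0 < p < 1 -> 0 < x -> 0 < y ->
  y `^ p <= x `^ p + p * x `^ (p - 1) * (y - x).
Proof.
move=> /andP[p0 p1] x0 y0.
have q0 : 0 < 1 - p by lra.
have r0 : 0 < y / x by exact: divr_gt0.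
have young : (y / x) `^ p <= 1 + p * (y / x - 1).
  have := @conjugate_powR _ ((y / x) `^ p) 1 p^-1 (1 - p)^-1.
  rewrite powR_ge0 ler01 !invr_gt0 p0 q0 !invrK mulr1 powR1 -powRrM.
  rewrite divff ?gt_eqF // powRr1 ?(ltW r0) //.
  move=> /(_ isT isT isT isT) H; have /H : p + (1 - p) = 1 by ring.
  by move=> {}H; apply: le_trans H _; lra.
have -> : y `^ p = x `^ p * (y / x) `^ p.
  by rewrite -powRM ?(ltW x0) ?(ltW r0) // mulrC divfK ?gt_eqF.
have -> : x `^ (p - 1) = x `^ p / x.
  by rewrite powRB ?powRr1 ?(ltW x0) // (gt_eqF x0) implybT.
apply: le_trans (ler_wpM2l (powR_ge0 _ _) young) _.
rewrite le_eqVlt; apply/orP; left; apply/eqP.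
by field; rewrite gt_eqF.
Qed.

Lemma cvg_natpowN s : 0 < s -> (fun n : nat => n%:R `^ (- s)) @ \oo --> (0 : R).
Proof.
move=> s0; apply/cvgrPdist_le => e e0.
exists (Num.bound (e^-1 `^ s^-1)).+1 => // n /= nb.
rewrite sub0r normrN ger0_norm ?powR_ge0 //.
have n0 : 0 < n%:R :> R by rewrite ltr0n; apply: leq_trans nb.
rewrite powRN -[leRHS]invrK lef_pV2 ?posrE ?invr_gt0 ?powR_gt0 //.
have -> : e^-1 = (e^-1 `^ s^-1) `^ s.
  by rewrite -powRrM mulVf ?gt_eqF // powRr1 // invr_ge0 ltW.
rewrite ge0_ler_powR ?nnegrE ?powR_ge0 ?(ltW s0) ?(ltW n0) //.
apply: le_trans (ltW (archi_boundP (powR_ge0 _ _))) _.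
by rewrite ler_nat ltnW.
Qed.

(** [T + v] decreases and [T - v] increases, so that both enclose a common
    value. *)
Lemma dominated_increments (T v : nat -> R) :
  (forall n, (0 < n)%N -> `|T n.+1 - T n| <= v n - v n.+1) ->
  (forall n, 0 <= v n) -> v @ \oo --> 0 ->
  T @ \oo --> limn T /\ forall n, (0 < n)%N -> `|T n - limn T| <= v n.
Proof.
move=> Tv v0 vcvg.
have mono m n : (0 < m)%N -> (m <= n)%N ->
    T m - v m <= T n - v n /\ T n + v n <= T m + v m.
  move=> m0 /subnKC <-; elim: (n - m)%N => [|k [IH1 IH2]]; first by rewrite addn0.
  rewrite addnS; have := Tv (m + k)%N; rewrite addn_gt0 m0 => /(_ isT).
  by rewrite ler_norml => /andP[A B]; split; lra.
have sep m n : (0 < m)%N -> (0 < n)%N -> T m - v m <= T n + v n.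
  move=> m0 n0; have [mn|/ltnW nm] := leqP m n.
    have [A _] := mono _ _ m0 mn; have := v0 n; lra.
  have [_ A] := mono _ _ n0 nm; have := v0 m; lra.
pose E := [set T n - v n | n in [set n | (0 < n)%N]].
have E1 : E !=set0 by exists (T 1%N - v 1%N), 1%N.
have close n : (0 < n)%N -> `|T n - sup E| <= v n.
  move=> n0; rewrite ler_distlC; apply/andP; split.
    apply: ub_le_sup; last by exists n.
    by exists (T 1%N + v 1%N) => _ [m m0 <-]; exact: sep.
  by apply: ge_sup => // _ [m m0 <-]; exact: sep.
have Tcvg : T @ \oo --> sup E.
  apply/cvgrPdist_le => e e0; move/cvgrPdist_le: vcvg => /(_ e e0) [N _ HN].
  exists N.+1 => // n /= Nn; rewrite distrC.
  have n0 : (0 < n)%N by apply: leq_trans Nn.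
  apply: le_trans (close n n0) _.
  have := HN n (ltnW Nn); rewrite /= sub0r normrN; exact/le_trans/ler_norm.
by rewrite (cvg_lim _ Tcvg).
Qed.

Definition wt s f (n : nat) : R := f n * n%:R `^ (- s).

(** The value [L(s, f)]. *)
Definition Dsum s f : R := limn (psum (wt s f)).

(** Partial summation: [psum (wt s f) n - psum f n * n ^ (- s)] has increments
    [psum f n * (n ^ (- s) - (n + 1) ^ (- s))], to which
    [dominated_increments] applies. *)
Lemma Dsum_rate s f (B : R) : 0 < s -> (forall n, `|psum f n| <= B) ->
  psum (wt s f) @ \oo --> Dsum s f /\
  forall n, (0 < n)%N -> `|psum (wt s f) n - Dsum s f| <= 2 * B * n%:R `^ (- s).
Proof.
move=> s0 fB.
have B0 : 0 <= B by apply: le_trans (fB 0%N).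
pose w (n : nat) : R := n%:R `^ (- s).
pose T n := psum (wt s f) n - psum f n * w n.
have wcvg : (fun n => B * w n) @ \oo --> (0 : R).
  by rewrite -(mulr0 B); apply: cvgMr; exact: cvg_natpowN.
have [||Tcvg Trate] := @dominated_increments T (fun n => B * w n) _ _ wcvg.
- move=> n n0; rewrite /T !psumS /wt -/(w _).
  have -> : psum (wt s f) n + f n.+1 * w n.+1 - (psum f n + f n.+1) * w n.+1 -
      (psum (wt s f) n - psum f n * w n) = psum f n * (w n - w n.+1) by ring.
  have w0 : 0 <= w n - w n.+1.
    by rewrite subr_ge0 ler_powRN ?ltr0n ?ler_nat ?(ltW s0).
  by rewrite normrM (ger0_norm w0) -mulrBr ler_wpM2r.
- by move=> n; rewrite mulr_ge0 ?powR_ge0.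
have Pcvg : (fun n => psum f n * w n) @ \oo --> (0 : R).
  apply/norm_cvg0P; apply: squeeze_cvgr (cvg_cst 0) wcvg.
  apply/nearW => n; rewrite normr_ge0 normrM (ger0_norm (powR_ge0 _ _)).
  by rewrite ler_wpM2r ?powR_ge0.
have Scvg : psum (wt s f) @ \oo --> limn T.
  rewrite -[limn T]addr0 (_ : psum _ = T \+ (fun n => psum f n * w n)).
    exact: cvgD.
  by apply/funext => n; rewrite /T /= subrK.
have -> : Dsum s f = limn T by exact: cvg_lim Scvg.
split=> // n n0; have := Trate n n0; have := fB n.
rewrite -/(w n) => Fn Tn.
have -> : psum (wt s f) n - limn T = T n - limn T + psum f n * w n.
  by rewrite /T; ring.
apply: le_trans (ler_normD _ _) _.
rewrite normrM (ger0_norm (powR_ge0 _ _)) -/(w n).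
have := ler_wpM2r (powR_ge0 n%:R (- s) : 0 <= w n) Fn.
by move: Tn; rewrite /=; lra.
Qed.
End Series.

(** * Power rates of convergence under convolution *)

Section Controlled.
Local Open Scope classical_set_scope.
Context {R : realType}.
Implicit Types (f g : nat -> R) (s p x y : R).

Lemma wt_dconv s f g n : (0 < n)%N ->
  wt s (dconv f g) n = dconv (wt s f) (wt s g) n.
Proof.
move=> n0; rewrite /wt !dconv_divisors // mulr_suml.
apply: eq_big_seq => d; rewrite -dvdn_divisors // => dn.
by rewrite mulrACA -powRM ?ler0n // -natrM mulnC divnK.
Qed.

Lemma ler_psum f g N : (forall n, (0 < n)%N -> f n <= g n) ->
  psum f N <= psum g N.
Proof.
by move=> fg; elim: N => [|N IH]; rewrite ?psum0 // !psumS lerD // fg.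
Qed.

Lemma ler_norm_psum f N : `|psum f N| <= psum (fun n => `|f n|) N.
Proof. exact: ler_norm_sum. Qed.

Lemma psum_norm_ge0 f N : 0 <= psum (fun n => `|f n|) N.
Proof. by rewrite sumr_ge0. Qed.

Lemma psum_norm_dconv f g N :
  psum (fun n => `|dconv f g n|) N <=
  psum (fun n => `|f n|) N * psum (fun n => `|g n|) N.
Proof.
apply: (@le_trans _ _ (psum (dconv (fun n => `|f n|) (fun n => `|g n|)) N)).
  apply: ler_psum => n n0; apply: le_trans (ler_norm_sum _ _ _) _.
  by apply: ler_sum => d _; rewrite normrM.
rewrite psum_dconv mulr_suml; apply: ler_sum => d _; apply: ler_wpM2l => //.
rewrite [leRHS](big_cat_nat _ (n := (N %/ d).+1)) //= ?ltnS ?leq_div //.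
by rewrite lerDl sumr_ge0.
Qed.

(** Convergence at the power rate [a], together with a growth bound for the
    absolute partial sums, is the information that the hyperbola method passes
    from two sequences to their convolution. *)
Definition controlled f (l K a k : R) := forall N, (0 < N)%N ->
  `|psum f N - l| <= K * N%:R `^ (- a) /\
  psum (fun n => `|f n|) N <= K * N%:R `^ k.

Lemma controlled_ge0 f l K a k : controlled f l K a k -> 0 <= K.
Proof. by move=> /(_ 1%N isT) [+ _]; rewrite powR1 mulr1; apply: le_trans. Qed.

Lemma controlled_weaken f l K a k K' a' k' : controlled f l K a k ->
  K <= K' -> a' <= a -> k <= k' -> controlled f l K' a' k'.
Proof.
move=> C KK aa kk N N0; have K0 := controlled_ge0 C; have [A B] := C N N0.
have N1 : 1 <= N%:R :> R by rewrite ler1n.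
split; [apply: le_trans A _|apply: le_trans B _];
  by rewrite ler_pM ?powR_ge0 // ler_powR ?lerN2.
Qed.

Lemma eq_controlled f g l K a k : (forall n, (0 < n)%N -> f n = g n) ->
  controlled f l K a k -> controlled g l K a k.
Proof.
move=> fg C N N0; have [A B] := C N N0; split; first by rewrite -(eq_psum _ fg).
by rewrite (@eq_psum _ _ (fun n => `|f n|)) // => n n0; rewrite fg.
Qed.

Lemma nat_sqrtP N : exists2 u, (u ^ 2 <= N)%N & (N < u.+1 ^ 2)%N.
Proof.
have ex : exists u, (u ^ 2 <= N)%N by exists 0%N.
have ub u : (u ^ 2 <= N)%N -> (u <= N)%N by rewrite expnS expn1; nia.
case: (ex_maxnP ex ub) => u uN umax; exists u => //.
by rewrite ltnNge; apply/negP => /umax; rewrite ltnn.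
Qed.

Lemma leq_sqr_double N u : (0 < u)%N -> (N < u.+1 ^ 2)%N -> (N <= (2 * u) ^ 2)%N.
Proof.
move=> u0 Nu; apply: leq_trans (ltnW Nu) _; rewrite leq_exp2r // mul2n -addnn.
by rewrite -addn1 leq_add2l.
Qed.

Lemma leq_div_root N u d : (u ^ 2 <= N)%N -> (0 < d <= u)%N -> (u <= N %/ d)%N.
Proof.
move=> uN /andP[d0 du]; rewrite leq_divRL //; apply: leq_trans uN.
by rewrite expnS expn1 leq_mul2l du orbT.
Qed.

(** In the hyperbola method [G d] is a partial sum of length [N %/ d], which is
    replaced by its main term [c d]. *)
Lemma psum_approx_fun f (G c : nat -> R) N (e : R) :
  (forall d, (0 < d <= N)%N -> `|G d - c d| <= e) ->
  `|psum (fun d => f d * G d) N - psum (fun d => f d * c d) N| <=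
  psum (fun n => `|f n|) N * e.
Proof.
move=> H; rewrite /psum mulr_suml -sumrB.
apply: le_trans (ler_norm_sum _ _ _) _.
rewrite big_nat_cond [leRHS]big_nat_cond; apply: ler_sum => d.
rewrite andbT ltnS => dN; rewrite -mulrBr normrM ler_wpM2l //.
exact: H.
Qed.

Lemma psum_approx f (G : nat -> R) N (c e : R) :
  (forall d, (0 < d <= N)%N -> `|G d - c| <= e) ->
  `|psum (fun d => f d * G d) N - psum f N * c| <= psum (fun n => `|f n|) N * e.
Proof. by move=> H; rewrite /psum mulr_suml; exact: psum_approx_fun. Qed.

(** With the hyperbola method cut at [u ~ sqrt N], all three error terms are at
    most [u ^ k * u ^ (- a)]; note that [F m + l G - F G = l m - (F - l) (G - m)]
    for the partial sums [F], [G] at [u].  The factor [12] is [3] error terms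
    times the loss [4] in [N <= (2 * u) ^ 2]. *)
Lemma controlled_dconv f g l m K K' a k : 0 <= k -> k <= a -> a <= 1 ->
  controlled f l K a k -> controlled g m K' a k ->
  controlled (dconv f g) (l * m) (12 * K * K') ((a - k) / 2) (2 * k).
Proof.
move=> k0 ka a1 Cf Cg N N0; split; last first.
  apply: le_trans (psum_norm_dconv _ _ _) _.
  have [_ Af] := Cf N N0; have [_ Ag] := Cg N N0.
  have K0 := controlled_ge0 Cf; have K'0 := controlled_ge0 Cg.
  apply: le_trans (ler_pM (psum_norm_ge0 _ _) (psum_norm_ge0 _ _) Af Ag) _.
  have -> : N%:R `^ (2 * k) = N%:R `^ k * N%:R `^ k :> R.
    by rewrite -powRD; [congr (_ `^ _); ring|rewrite pnatr_eq0 -lt0n N0 implybT].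
  have := mulr_ge0 (mulr_ge0 K0 K'0) (mulr_ge0 (powR_ge0 N%:R k) (powR_ge0 N%:R k)).
  by rewrite mulrACA; lra.
have [u uN Nu] := nat_sqrtP N.
have u0 : (0 < u)%N by move: Nu N0; case: (u) => // ; case: (N) => // ?; rewrite exp1n.
have uR : 1 <= u%:R :> R by rewrite ler1n.
have uR0 : 0 < u%:R :> R by rewrite ltr0n.
have K0 := controlled_ge0 Cf; have K'0 := controlled_ge0 Cg.
have a0 : 0 <= a by lra.
have [Ff Af] := Cf u u0; have [Fg Ag] := Cg u u0.
set e := u%:R `^ (k - a).
have eE : e = u%:R `^ k * u%:R `^ (- a).
  by rewrite /e powRD // (gt_eqF uR0) implybT.
have ae : u%:R `^ (- a) <= e by rewrite /e ler_powR //; lra.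
have ua0 : 0 <= u%:R `^ (- a) :> R by exact: powR_ge0.
have ua1 : u%:R `^ (- a) <= 1 :> R.
  by rewrite -[leRHS](powRr0 u%:R) ler_powR //; lra.
have near (h : nat -> R) c (J : R) : controlled h c J a k -> forall d, (0 < d <= u)%N ->
    `|psum h (N %/ d) - c| <= J * u%:R `^ (- a).
  move=> Ch d du; have ud := leq_div_root uN du.
  have [+ _] := Ch _ (leq_trans u0 ud); move/le_trans; apply.
  by rewrite ler_wpM2l ?(controlled_ge0 Ch) // ler_powRN // ler_nat.
have E1 := psum_approx f (near _ _ _ Cg).
have E2 := psum_approx g (near _ _ _ Cf).
have B1 : psum (fun n => `|f n|) u * (K' * u%:R `^ (- a)) <= K * K' * e.
  rewrite eE; apply: le_trans (ler_wpM2r _ Af) _; first by rewrite mulr_ge0.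
  by rewrite le_eqVlt; apply/orP; left; apply/eqP; ring.
have B2 : psum (fun n => `|g n|) u * (K * u%:R `^ (- a)) <= K * K' * e.
  rewrite eE; apply: le_trans (ler_wpM2r _ Ag) _; first by rewrite mulr_ge0.
  by rewrite le_eqVlt; apply/orP; left; apply/eqP; ring.
have B3 : `|(psum f u - l) * (psum g u - m)| <= K * K' * e.
  rewrite normrM; apply: le_trans (ler_pM _ _ Ff Fg) _ => //.
  rewrite mulrACA ler_wpM2l ?mulr_ge0 //.
  by apply: le_trans ae; rewrite ler_piMr.
have eN : e <= 4 * N%:R `^ (- ((a - k) / 2)).
  have t0 : 0 <= (a - k) / 2 by lra.
  have t1 : (a - k) / 2 <= 1 by lra.
  have -> : e = (u%:R ^+ 2) `^ (- ((a - k) / 2)).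
    rewrite -powR_mulrn ?(ltW uR0) // -powRrM; congr (_ `^ _); by field.
  have N4 : N%:R / 4 <= u%:R ^+ 2 :> R.
    have := leq_sqr_double u0 Nu; rewrite -(ler_nat R) natrX natrM exprMn => u2.
    have -> : u%:R ^+ 2 = (2 ^+ 2 * u%:R ^+ 2) / 4 :> R by field.
    by rewrite ler_pM2r // invr_gt0.
  have NR0 : 0 < N%:R / 4 :> R by rewrite divr_gt0 ?ltr0n //.
  apply: le_trans (ler_powRN NR0 N4 t0) _.
  rewrite powRM ?ler0n ?invr_ge0 // mulrC ler_wpM2r ?powR_ge0 //.
  rewrite -powR_inv1 ?ler0n // -powRrM mulN1r opprK.
  by rewrite -[leRHS]powRr1 ?ler0n // ler_powR // ler1n.
rewrite (hyperbola f g uN Nu).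
have -> : psum (fun d => f d * psum g (N %/ d)%N) u +
    psum (fun d => g d * psum f (N %/ d)%N) u - psum f u * psum g u - l * m =
  (psum (fun d => f d * psum g (N %/ d)%N) u - psum f u * m) +
  (psum (fun d => g d * psum f (N %/ d)%N) u - psum g u * l) -
  (psum f u - l) * (psum g u - m) by ring.
apply: le_trans (ler_normB _ _) _.
apply: (@le_trans _ _ (3 * (K * K' * e))).
  have := ler_normD (psum (fun d => f d * psum g (N %/ d)%N) u - psum f u * m)
    (psum (fun d => g d * psum f (N %/ d)%N) u - psum g u * l).
  lra.
by have := ler_wpM2l (mulr_ge0 K0 K'0) eN; lra.
Qed.
End Controlled.

(** * The zeta function on (0, 1) and the main asymptotics *)

Section Zeta.
Local Open Scope classical_set_scope.
Context {R : realType}.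
Implicit Types (f g : nat -> R) (s p x y : R).

Lemma natpow_step p N : 0 < p < 1 -> (0 < N)%N ->
  (p : R) * N.+1%:R `^ (p - 1) <= N.+1%:R `^ p - N%:R `^ p <= p * N%:R `^ (p - 1).
Proof.
move=> p01 N0; have N0' : 0 < N%:R :> R by rewrite ltr0n.
have := powR_tangent p01 N0' (ltr0Sn R N).
have := powR_tangent p01 (ltr0Sn R N) N0'.
have e1 : N.+1%:R - N%:R = 1 :> R by rewrite -natr1; ring.
have e2 : N%:R - N.+1%:R = -1 :> R by rewrite -natr1; ring.
by rewrite e1 e2 => A B; apply/andP; split; lra.
Qed.

Lemma psum_natpow_le p N : 0 < p < 1 ->
  psum (fun n => n%:R `^ (p - 1)) N <= N%:R `^ p / p.
Proof.
move=> p01; have /andP[p0 p1] := p01.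
elim: N => [|[_|N IH]].
- by rewrite psum0 divr_ge0 ?powR_ge0 ?ltW.
- by rewrite psumS psum0 add0r !powR1 mul1r -invr1 lef_pV2 ?posrE ?ltW.
rewrite psumS; apply: le_trans (lerD IH (lexx _)) _.
have /andP[+ _] := natpow_step p01 (ltn0Sn N).
rewrite -lerBrDl -mulrBl ler_pdivlMr // mulrC; lra.
Qed.

(** For [0 < s < 1] this is the value of Riemann's function at [s]. *)
Definition zeta s : R :=
  limn (fun N => psum (wt s one) N - N%:R `^ (1 - s) / (1 - s)).

Lemma psum_wt_one_le s N : 0 < s < 1 ->
  psum (wt s one) N <= N%:R `^ (1 - s) / (1 - s).
Proof.
move=> s01; have p01 : 0 < 1 - s < 1 by lra.
have := psum_natpow_le N p01; congr (_ <= _).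
apply: eq_psum => n _; rewrite /wt mul1r; congr (_ `^ _); ring.
Qed.

(** By [natpow_step] the increments of [N ^ (1 - s) / (1 - s)] lie between
    [(N + 1) ^ (- s)] and [N ^ (- s)], so that [N ^ (- s)] dominates the
    increments of the difference. *)
Lemma zeta_rate s : 0 < s < 1 ->
  (fun N => psum (wt s one) N - N%:R `^ (1 - s) / (1 - s)) @ \oo --> zeta s /\
  forall N, (0 < N)%N ->
    `|psum (wt s one) N - N%:R `^ (1 - s) / (1 - s) - zeta s| <= N%:R `^ (- s).
Proof.
move=> s01; have p01 : 0 < 1 - s < 1 by lra.
have p0 : 0 < 1 - s by lra.
apply: (@dominated_increments _ _ (fun N => N%:R `^ (- s))).
- move=> N N0; rewrite psumS /wt mul1r.
  have /andP[] := natpow_step p01 N0.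
  have -> : 1 - s - 1 = - s by ring.
  move=> A B; move: (A) (B).
  rewrite mulrC -(ler_pdivlMr _ _ p0) [in X in _ -> X -> _]mulrC -(ler_pdivrMr _ _ p0).
  rewrite !mulrBl => {}A {}B.
  by rewrite ler_norml; apply/andP; split; lra.
- by move=> N; exact: powR_ge0.
- by apply: cvg_natpowN; case/andP: s01.
Qed.

Lemma zeta_le0 s : 0 < s < 1 -> zeta s <= 0.
Proof.
move=> s01; have [zc _] := zeta_rate s01.
apply: (cvgr_to_le zc); apply: nearW => N.
by rewrite subr_le0 psum_wt_one_le.
Qed.

(** The main term is evaluated at a real [y], because the hyperbola method needs
    it at [N / d] while the sum stops at the integer part [N %/ d]. *)
Lemma zeta_approx s y N : 0 < s < 1 -> (0 < N)%N -> N%:R <= y <= N.+1%:R ->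
  `|psum (wt s one) N - (y `^ (1 - s) / (1 - s) + zeta s)| <= 2 * N%:R `^ (- s).
Proof.
move=> s01 N0 /andP[Ny yN]; have [_ /(_ N N0) zr] := zeta_rate s01.
have p01 : 0 < 1 - s < 1 by lra.
have p0 : 0 < 1 - s by lra.
have NR : 0 < N%:R :> R by rewrite ltr0n.
have y0 : 0 < y by exact: lt_le_trans Ny.
have := powR_tangent p01 NR y0.
have -> : 1 - s - 1 = - s by ring.
have := ler_wpM2l (powR_ge0 N%:R (- s)) (_ : y - N%:R <= 1).
have -> : y - N%:R <= 1 by move: yN; rewrite -natr1; lra.
move=> /(_ isT); rewrite mulr1 => A B.
have C : N%:R `^ (1 - s) <= y `^ (1 - s).
  by rewrite ge0_ler_powR ?nnegrE ?(ltW p0) ?(ltW NR) ?(ltW y0).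
have : `|(y `^ (1 - s) - N%:R `^ (1 - s)) / (1 - s)| <= N%:R `^ (- s).
  have q0 : 0 <= (y `^ (1 - s) - N%:R `^ (1 - s)) / (1 - s).
    by rewrite divr_ge0 ?(ltW p0) // subr_ge0.
  rewrite (ger0_norm q0) ler_pdivrMr //.
  move: B; rewrite -mulrA; have := ler_wpM2l (ltW p0) A; lra.
move: zr; rewrite !ler_norml => /andP[z1 z2] /andP[d1 d2].
by apply/andP; move: d1 d2; rewrite !mulrBl; split; lra.
Qed.

(** The hyperbola method for [zeta(s) sum f(n) n^-s], cut at the square root.
    The main term and its error come from inserting [zeta_approx] into the sum
    over the small divisors carrying [f]; the rest collapses to
    [(Z - zeta s) (F - l)] for the partial sums [Z] and [F] of the two factors. *)
Lemma rep_asymptotics s f (l lam A B b b' k : R) : 0 < s < 1 ->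
  (forall N, (0 < N)%N -> `|psum (wt s f) N - l| <= B * N%:R `^ (- b)) ->
  (forall N, (0 < N)%N -> `|psum (wt 1 f) N - lam| <= B * N%:R `^ (- b')) ->
  (forall N, (0 < N)%N -> psum (fun n => `|wt s f n|) N <= A * N%:R `^ k) ->
  0 <= b ->
  forall M, (0 < M)%N ->
  `|psum (wt s (rep f)) (M ^ 2)%N -
    (lam * M%:R `^ (2 * (1 - s)) / (1 - s) + zeta s * l)| <=
  B / (1 - s) * (M%:R `^ (2 * (1 - s) - b') + 3 * M%:R `^ (1 - s - b)) +
  2 * A * M%:R `^ (k - s).
Proof.
move=> s01 Fs F1 Fabs b0 M M0.
have p0 : 0 < 1 - s by lra.
have s0 : 0 <= s by lra.
set p := 1 - s in p0 *; set N := (M ^ 2)%N; set Z := wt s one; set F := wt s f.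
have MR : 0 < M%:R :> R by rewrite ltr0n.
have MD x y : M%:R `^ (x + y) = M%:R `^ x * M%:R `^ y :> R.
  by rewrite powRD // (gt_eqF MR) implybT.
have NE : N%:R `^ p = M%:R `^ (2 * p) :> R.
  by rewrite /N natrX -powR_mulrn ?ler0n // -powRrM.
have -> : psum (wt s (rep f)) N =
    psum (fun d => F d * psum Z (N %/ d)) M +
    psum (fun m => Z m * psum F (N %/ m)) M - psum F M * psum Z M.
  rewrite -hyperbola ?ltn_exp2r //; apply: eq_psum => n n0.
  by rewrite wt_dconv // dconvC.
pose c d : R := (N%:R / d%:R) `^ p / p + zeta s.
have E1 : `|psum (fun d => F d * psum Z (N %/ d)) M -
    psum (fun d => F d * c d) M| <= A * M%:R `^ k * (2 * M%:R `^ (- s)).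
  apply: le_trans (psum_approx_fun F _) (ler_wpM2r _ (Fabs M M0)); last first.
    by rewrite mulr_ge0 ?powR_ge0.
  move=> d dM; have Md := leq_div_root (leqnn N) dM.
  have q0 := leq_trans M0 Md; have /andP[d0 _] := dM.
  have dR : 0 < d%:R :> R by rewrite ltr0n.
  apply: le_trans (zeta_approx s01 q0 _) _.
    rewrite ler_pdivlMr // ler_pdivrMr // -!natrM !ler_nat leq_divM /=.
    exact/ltnW/ltn_ceil.
  by rewrite ler_wpM2l // ler_powRN // ler_nat.
have cE : psum (fun d => F d * c d) M =
    M%:R `^ (2 * p) / p * psum (wt 1 f) M + zeta s * psum F M.
  rewrite /psum !mulr_sumr -big_split /=; apply: eq_big_nat => d /andP[d0 _].
  have dR : 0 < d%:R :> R by rewrite ltr0n.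
  rewrite /c -NE powRM ?ler0n ?invr_ge0 // -[d%:R^-1]powR_inv1 ?ler0n //.
  rewrite -powRrM mulN1r mulrDr [F d * zeta s]mulrC; congr (_ + _).
  have -> : wt 1 f d = F d * d%:R `^ (- p).
    rewrite /wt -mulrA -powRD ?(gt_eqF dR) ?implybT //; congr (_ * _ `^ _).
    by rewrite /p; ring.
  by ring.
have E2 : `|psum (fun m => Z m * psum F (N %/ m)) M - psum Z M * l| <=
    M%:R `^ p / p * (B * M%:R `^ (- b)).
  have B0 : 0 <= B * M%:R `^ (- b) by apply: le_trans (Fs M M0).
  apply: le_trans (psum_approx Z (e := B * M%:R `^ (- b)) _) _.
    move=> d dM; have Md := leq_div_root (leqnn N) dM.
    apply: le_trans (Fs _ (leq_trans M0 Md)) _.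
    rewrite ler_wpM2l ?ler_powRN ?ler_nat //.
    by have := Fs 1%N isT; rewrite powR1 mulr1; apply: le_trans.
  rewrite ler_wpM2r // (_ : psum _ _ = psum Z M) ?psum_wt_one_le //.
  by apply: eq_psum => n n0; rewrite ger0_norm // /Z /wt mul1r powR_ge0.
have B0 : 0 <= B by have := Fs 1%N isT; rewrite powR1 mulr1; apply: le_trans.
have p1 : p < 1 by rewrite /p; lra.
have E3 : `|(psum Z M - zeta s) * (psum F M - l)| <=
    2 * (M%:R `^ p / p) * (B * M%:R `^ (- b)).
  rewrite normrM ler_pM ?Fs //.
  have [_ /(_ M M0)] := zeta_rate s01; rewrite -/p -/Z => zr.
  have sp : M%:R `^ (- s) <= M%:R `^ p / p.
    rewrite ler_pdivlMr //; apply: (@le_trans _ _ (M%:R `^ (- s))).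
      by rewrite ler_piMr ?powR_ge0 // ltW.
    by rewrite ler_powR ?ler1n // /p; lra.
  have q0 : 0 <= M%:R `^ p / p by rewrite divr_ge0 ?powR_ge0 ?ltW.
  by move: zr; rewrite !ler_norml => /andP[z1 z2]; apply/andP; split; lra.
have E4 : `|M%:R `^ (2 * p) / p * (psum (wt 1 f) M - lam)| <=
    M%:R `^ (2 * p) / p * (B * M%:R `^ (- b')).
  have q0 : 0 <= M%:R `^ (2 * p) / p by rewrite divr_ge0 ?powR_ge0 ?ltW.
  by rewrite normrM (ger0_norm q0) ler_wpM2l ?F1.
have -> : psum (fun d => F d * psum Z (N %/ d)) M +
    psum (fun m => Z m * psum F (N %/ m)) M - psum F M * psum Z M -
    (lam * M%:R `^ (2 * p) / p + zeta s * l) =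
    (psum (fun d => F d * psum Z (N %/ d)) M - psum (fun d => F d * c d) M) +
    (psum (fun m => Z m * psum F (N %/ m)) M - psum Z M * l) -
    (psum Z M - zeta s) * (psum F M - l) +
    M%:R `^ (2 * p) / p * (psum (wt 1 f) M - lam).
  by rewrite cE; ring.
have -> : B / p * (M%:R `^ (2 * p - b') + 3 * M%:R `^ (p - b)) +
    2 * A * M%:R `^ (k - s) =
    A * M%:R `^ k * (2 * M%:R `^ (- s)) + M%:R `^ p / p * (B * M%:R `^ (- b)) +
    2 * (M%:R `^ p / p) * (B * M%:R `^ (- b)) +
    M%:R `^ (2 * p) / p * (B * M%:R `^ (- b')).
  by rewrite !MD; ring.
apply: le_trans (ler_normD _ _) _; apply: lerD => //.
apply: le_trans (ler_normB _ _) _; apply: lerD => //.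
by apply: le_trans (ler_normD _ _) _; apply: lerD.
Qed.
End Zeta.

(** * L-functions of real characters *)

Section RealCharacters.
Local Open Scope classical_set_scope.
Context {R : realType}.
Implicit Types (f g : nat -> R) (s p x y : R) (q : nat).

Definition real_char q f :=
  [/\ (0 < q)%N, sign_hom f, forall n, f (n + q)%N = f n &
      \sum_(0 <= i < q) f i = 0].

Lemma real_char0 q f : real_char q f -> f 0%N = 0.
Proof.
(* [f 0 * f i = f 0] turns the vanishing period sum into [q * f 0 = 0] *)
move=> [q0 [_ fM _] _ fs]; have := congr1 ( *%R (f 0%N)) fs.
rewrite mulr0 mulr_sumr (eq_bigr (fun=> f 0%N)) => [|i _]; last first.
  by rewrite -fM mul0n.
rewrite big_const_nat subn0 iter_addr_0 => /eqP.
by rewrite mulrn_eq0 -[q == _]negbK -lt0n q0 => /eqP.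
Qed.

Lemma real_char_psum q f N : real_char q f -> `|psum f N| <= q%:R.
Proof.
move=> cf; have f0 := real_char0 cf; have [q0 hf fq fs] := cf.
have -> : psum f N = \sum_(0 <= i < N.+1) f i.
  by rewrite [RHS]big_ltn // f0 add0r.
move: N.+1 => {}N; rewrite {1}(divn_eq N q).
(* complete periods cancel, and fewer than [q] terms remain *)
elim: (N %/ q)%N => [|k IH].
  rewrite mul0n add0n; apply: le_trans (ler_norm_sum _ _ _) _.
  apply: (@le_trans _ _ (\sum_(0 <= i < N %% q) 1)).
    by apply: ler_sum => i _; exact: sign_hom_le1.
  by rewrite big_const_nat subn0 iter_addr_0 ler_nat ltnW // ltn_pmod.
rewrite mulSn -addnA (big_cat_nat _ (n := q)) ?leq_addr //= fs add0r.
rewrite -{1}[q]add0n big_addn addKn.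
by under eq_bigr do rewrite fq.
Qed.

Lemma Dsum_real_char q f s : real_char q f -> 0 < s ->
  psum (wt s f) @ \oo --> Dsum s f /\ forall n, (0 < n)%N ->
    `|psum (wt s f) n - Dsum s f| <= 2 * q%:R * n%:R `^ (- s).
Proof. by move=> cf s0; apply: Dsum_rate => // n; exact: real_char_psum. Qed.

Lemma psum_norm_wt f s k N : sign_hom f -> 0 < k < 1 -> 1 - s <= k ->
  psum (fun n => `|wt s f n|) N <= N%:R `^ k / k.
Proof.
move=> hf k01 sk; apply: le_trans _ (psum_natpow_le N k01).
apply: ler_psum => n n0; rewrite /wt normrM (ger0_norm (powR_ge0 _ _)).
rewrite -[leRHS]mul1r ler_pM ?powR_ge0 ?sign_hom_le1 //.
by rewrite ler_powR ?ler1n //; lra.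
Qed.

Lemma controlled_real_char q f s k : real_char q f -> 1 / 2 <= s -> 0 < k < 1 ->
  1 - s <= k -> controlled (wt s f) (Dsum s f) (2 * q%:R / k) (1 / 2) k.
Proof.
move=> cf s2 k01 sk N N0; have [q0 hf _ _] := cf.
have [|_ /(_ N N0) fs] := Dsum_real_char cf (_ : 0 < s); first by lra.
have /andP[k0 k1] := k01; have q1 : 1 <= q%:R :> R by rewrite ler1n.
have N1 : 1 <= N%:R :> R by rewrite ler1n.
split.
  apply: le_trans fs _; rewrite ler_pM ?mulr_ge0 ?powR_ge0 //.
    by rewrite ler_pdivlMr // ler_piMr ?mulr_ge0 // ltW.
  by rewrite ler_powR // lerN2.
apply: le_trans (psum_norm_wt N hf k01 sk) _.
rewrite mulrC ler_wpM2r ?powR_ge0 // ler_pdivlMr // mulVf ?gt_eqF //; lra.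
Qed.

(** Cutting the series at the modulus: beyond it the tail is [O(1)], and the
    first [q] terms are bounded trivially. *)
Lemma Dsum1_le q f k : real_char q f -> 0 < k < 1 ->
  `|Dsum 1 f| <= (2 + 1 / k) * q%:R `^ k.
Proof.
move=> cf k01; have [q0 hf _ _] := cf.
have q1 : 1 <= q%:R :> R by rewrite ler1n.
have [_ /(_ q q0) B] := Dsum_real_char cf ltr01.
have sk : 1 - 1 <= k by lra.
have A := le_trans (ler_norm_psum (wt 1 f) q) (psum_norm_wt q hf k01 sk).
rewrite -mulrA powR_inv1 ?ler0n // divff in B; last by rewrite pnatr_eq0 -lt0n.
have X : 1 <= q%:R `^ k by rewrite -[leLHS](powRr0 q%:R) ler_powR //; lra.
have -> : (2 + 1 / k) * q%:R `^ k = q%:R `^ k / k + 2 * q%:R `^ k by ring.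
have -> : Dsum 1 f = psum (wt 1 f) q - (psum (wt 1 f) q - Dsum 1 f) by ring.
by apply: le_trans (ler_normB _ _) _; lra.
Qed.

Lemma harmonic_unbounded (C : R) : exists2 N, (0 < N)%N & C < psum (fun n => n%:R^-1) N.
Proof.
apply: contrapT => H; apply: (@dvg_harmonic R).
apply: nondecreasing_is_cvgn.
  by apply: nondecreasing_series => n _ _; exact: harmonic_ge0.
exists C => _ [N _ <-]; rewrite leNgt; apply/negP => CN; apply: H.
exists N.+1 => //; rewrite psumS ltr_wpDr ?invr_ge0 //.
by rewrite /psum big_add1 /=.
Qed.

Lemma psum_wt_ge f s N M : (forall n, (0 < n)%N -> 0 <= f n) -> (N <= M)%N ->
  psum (wt s f) N <= psum (wt s f) M.
Proof.
move=> f0 /subnKC <-; elim: (M - N)%N => [|k IH]; first by rewrite addn0.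
by rewrite addnS psumS ler_wpDr // mulr_ge0 ?powR_ge0 ?f0.
Qed.

(** If [L(1, f) <= 0] the asymptotics at [s = 1 / 2] bound the partial sums of
    [rep f n / sqrt n], although the squares alone contribute a harmonic
    series. *)
Lemma Dsum1_gt0 q f : real_char q f -> 0 < Dsum 1 f.
Proof.
move=> cf; have [q0 hf _ _] := cf; rewrite ltNge; apply/negP => L0.
have h01 : 0 < (1 / 2 : R) < 1 by lra.
have h0 : 0 < 1 / 2 :> R by lra.
have [_ F2] := Dsum_real_char cf h0.
have [_ F1] := Dsum_real_char cf ltr01.
have Fa N : (0 < N)%N -> psum (fun n => `|wt (1 / 2) f n|) N <= 2 * N%:R `^ (1 / 2).
  move=> N0; have h2 : 1 - 1 / 2 <= 1 / 2 :> R by lra.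
  have -> : 2 * N%:R `^ (1 / 2) = N%:R `^ (1 / 2) / (1 / 2) :> R by field.
  exact: psum_norm_wt.
have main := rep_asymptotics h01 F2 F1 Fa (ltW h0).
have [M M0] := harmonic_unbounded
  (zeta (1 / 2) * Dsum (1 / 2) f + 2 * q%:R / (1 / 2) * 4 + 4).
have lower N : psum (fun n => n%:R^-1) N <= psum (wt (1 / 2) (rep f)) (N ^ 2)%N.
  elim: N => [|N IH]; first by rewrite !psum0.
  have e : ((N.+1 ^ 2) = (N.+1 ^ 2).-1.+1)%N by rewrite prednK // expn_gt0.
  rewrite psumS [in leRHS]e psumS -e lerD //.
    apply: le_trans IH _; apply: psum_wt_ge => [n n0|]; first exact: rep_ge0.
    by rewrite -ltnS -e ltn_exp2r.
  rewrite /wt natrX -powR_mulrn // -powRrM.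
  have -> : 2%:R * - (1 / 2) = -1 :> R by field.
  by rewrite powR_inv1 // ler_peMl ?invr_ge0 ?rep_sqr_ge1.
have e1 : 2 * (1 - 1 / 2) - 1 = 0 :> R by field.
have e2 : 1 - 1 / 2 - 1 / 2 = 0 :> R by field.
have := main M M0; rewrite e1 e2 subrr !powRr0.
have : Dsum 1 f * M%:R `^ (2 * (1 - 1 / 2)) / (1 - 1 / 2) <= 0.
  rewrite -mulrA mulr_le0_ge0 // mulr_ge0 ?powR_ge0 // invr_ge0; lra.
move: (Dsum 1 f * _ / _) => X X0.
have -> : 1 - 1 / 2 = 1 / 2 :> R by field.
rewrite ler_norml => /andP[_ U] V; have := lower M; lra.
Qed.

Lemma continuous_psum_wt f N : continuous (fun s => psum (wt s f) N).
Proof.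
move=> s; elim: N => [|N IH].
  under eq_fun do rewrite psum0; exact: cvg_cst.
under eq_fun do rewrite psumS.
apply: cvgD; first exact: IH.
rewrite /wt; apply: cvgMr.
rewrite /powR pnatr_eq0 /=.
apply: (@continuous_comp _ _ _ (fun s : R => - s * ln N.+1%:R) expR).
  by apply: cvgMl; apply: cvgN; exact: cvg_id.
exact: continuous_expR.
Qed.

(** The rate of convergence is uniform for [t >= s / 2], so that the continuity of
    a single partial sum suffices. *)
Lemma continuous_Dsum q f s : real_char q f -> 0 < s ->
  {for s, continuous (fun s => Dsum s f)}.
Proof.
move=> cf s0; have [q0 _ _ _] := cf.
apply/cvgrPdist_le => e e0.
have c0 : 0 < s / 2 by lra.
have e3 : 0 < e / 3 by lra.
have vc : (fun n : nat => 2 * q%:R * n%:R `^ (- (s / 2))) @ \oo --> (0 : R).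
  by rewrite -(mulr0 (2 * q%:R)); apply: cvgMr; exact: cvg_natpowN.
move/cvgrPdist_le: vc => /(_ _ e3) [N _ HN].
have vN : 2 * q%:R * N.+1%:R `^ (- (s / 2)) <= e / 3.
  have := HN N.+1 (leqnSn N); rewrite /= sub0r normrN; exact/le_trans/ler_norm.
have near t : s / 2 <= t -> `|psum (wt t f) N.+1 - Dsum t f| <= e / 3.
  move=> st; have [|_ /(_ N.+1 isT) H] := Dsum_real_char cf (_ : 0 < t); first lra.
  apply: le_trans H (le_trans _ vN); rewrite ler_wpM2l ?mulr_ge0 //.
  by rewrite ler_powR ?ler1n // lerN2.
have /cvgrPdist_le /(_ _ e3) cont := @continuous_psum_wt f N.+1 s.
near=> t.
have st : s / 2 <= t.
  by apply: ltW; near: t; apply: lt_nbhsr; lra.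
have A : `|psum (wt s f) N.+1 - psum (wt t f) N.+1| <= e / 3 by near: t.
have ss : s / 2 <= s by clear -s0; lra.
have B := near _ st; have C := near s ss.
have -> : Dsum s f - Dsum t f = (psum (wt s f) N.+1 - psum (wt t f) N.+1) +
  (psum (wt t f) N.+1 - Dsum t f) - (psum (wt s f) N.+1 - Dsum s f) by ring.
apply: le_trans (ler_normB _ _) _.
have := ler_normD (psum (wt s f) N.+1 - psum (wt t f) N.+1)
  (psum (wt t f) N.+1 - Dsum t f).
by clear -A B C; lra.
Unshelve. all: by end_near. Qed.

Lemma Dsum_zero q f s : real_char q f -> 0 < s < 1 -> Dsum s f < 0 ->
  exists2 t, s <= t < 1 & Dsum t f = 0.
Proof.
move=> cf /andP[s0 s1] Ls; have L1 := Dsum1_gt0 cf.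
have cont : {within `[s, 1], continuous (fun t => Dsum t f)}.
  apply: continuous_in_subspaceT => t; rewrite inE /= in_itv /= => /andP[st _].
  by apply: continuous_Dsum cf _; exact: lt_le_trans st.
have [|t] := IVT (ltW s1) cont (v := 0).
  by rewrite ge_min le_max (ltW Ls) (ltW L1) orbT.
rewrite in_itv /= => /andP[st t1] Lt; exists t => //.
rewrite st lt_neqAle t1 andbT; apply/eqP => te.
by move: L1; rewrite -te Lt ltxx.
Qed.
End RealCharacters.

(** * Lower bounds from the asymptotics *)

Section Siegel.
Local Open Scope classical_set_scope.
Context {R : realType}.
Implicit Types (f g : nat -> R) (s p x y : R) (q : nat).

(** Taking [M] to be about [(2 D x) ^ (1 / d)] makes the error term at most
    [1 / 2], so that the main term is at least [1 / 2]. *)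
Lemma lower_bound_from_asymptotics (D d p : R) : 1 <= D -> 0 < d -> 0 < p ->
  exists2 c : R, 0 < c & forall x lam, 1 <= x ->
    (forall M, (0 < M)%N ->
      1 <= lam * M%:R `^ (2 * p) / p + D * x * M%:R `^ (- d)) ->
    c * x `^ (- (2 * p / d)) <= lam.
Proof.
move=> D1 d0 p0.
have D0 : 0 < 2 * D by lra.
pose c0 : R := 2 * (2 * D) `^ d^-1.
have c00 : 0 < c0 by rewrite mulr_gt0 ?powR_gt0.
exists (p / 2 * c0 `^ (- (2 * p))); first by rewrite mulr_gt0 ?powR_gt0 ?divr_gt0.
move=> x lam x1 H; have x0 : 0 < x by lra.
have Dx : 1 <= D * x by rewrite mulr_ege1.
pose y := (2 * D * x) `^ d^-1.
have y1 : 1 <= y.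
  rewrite -[leLHS](powRr0 (2 * D * x)) ler_powR ?invr_ge0 ?ltW //.
  lra.
have y0 : 0 < y by lra.
have [M Mpos [MR M2]] : exists2 M, (0 < M)%N & y <= M%:R /\ M%:R <= 2 * y.
  have /andP[My yM] := truncn_itv (ltW y0).
  exists (Num.truncn y).+1 => //; split; first exact: ltW.
  by rewrite -natr1; lra.
have M0 : 0 < M%:R :> R by exact: lt_le_trans MR.
have Dx0 : 0 <= D * x by lra.
have E : D * x * M%:R `^ (- d) <= 1 / 2.
  apply: (@le_trans _ _ (D * x * y `^ (- d))).
    exact: ler_wpM2l Dx0 _ _ (ler_powRN y0 MR (ltW d0)).
  rewrite /y -powRrM mulrN mulVf ?gt_eqF // powR_inv1; last by lra.
  by rewrite le_eqVlt; apply/orP; left; apply/eqP; field; rewrite !gt_eqF //; lra.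
have main := H M Mpos.
have {}main : 1 / 2 <= lam * M%:R `^ (2 * p) / p by lra.
have {main} : p / 2 * M%:R `^ (- (2 * p)) <= lam.
  rewrite powRN ler_pdivrMr ?powR_gt0 //.
  move: main; rewrite ler_pdivlMr //; lra.
apply: le_trans; rewrite -mulrA ler_wpM2l ?divr_ge0 ?(ltW p0) //.
have -> : c0 `^ (- (2 * p)) * x `^ (- (2 * p / d)) = (2 * y) `^ (- (2 * p)).
  have -> : 2 * y = c0 * x `^ d^-1.
    by rewrite /y powRM ?ltW // /c0 mulrA.
  rewrite powRM ?powR_ge0 ?(ltW c00) // -powRrM; congr (_ * _ `^ _).
  by rewrite mulrN; congr (- _); rewrite mulrC.
by rewrite ler_powRN // mulr_ge0 // ltW.
Qed.

(** Nonnegativity and [rep f 1 = 1] make the partial sums at least [1], and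
    [zeta s <= 0 <= l] makes the second main term nonpositive. *)
Lemma rep_lower_bound s f (l lam K a k d : R) : 0 < s < 1 ->
  (forall n, (0 < n)%N -> 0 <= rep f n) -> rep f 1 = 1 -> 0 <= l ->
  controlled (wt s f) l K a k -> controlled (wt 1 f) lam K a k -> 0 <= a ->
  2 * (1 - s) - a <= - d -> k - s <= - d ->
  forall M, (0 < M)%N ->
    1 <= lam * M%:R `^ (2 * (1 - s)) / (1 - s) + 6 * K / (1 - s) * M%:R `^ (- d).
Proof.
move=> s01 r0 r1 l0 Cs C1 a0 ad kd M M0.
have p0 : 0 < 1 - s by lra.
have K0 := controlled_ge0 Cs.
have M1 : 1 <= M%:R :> R by rewrite ler1n.
have := rep_asymptotics s01 (fun N N0 => (Cs N N0).1) (fun N N0 => (C1 N N0).1)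
  (fun N N0 => (Cs N N0).2) a0 M0.
have one_le : 1 <= psum (wt s (rep f)) (M ^ 2)%N.
  have <- : psum (wt s (rep f)) 1 = 1.
    by rewrite psumS psum0 add0r /wt powR1 r1 mulr1.
  by apply: psum_wt_ge => //; rewrite expn_gt0 M0.
have zl : zeta s * l <= 0 by rewrite mulr_le0_ge0 ?zeta_le0.
rewrite ler_norml => /andP[_ U].
have Md t : t <= - d -> M%:R `^ t <= M%:R `^ (- d) by move=> td; rewrite ler_powR.
have e1 := Md _ ad; have e2 : M%:R `^ (1 - s - a) <= M%:R `^ (- d).
  by apply: Md; lra.
have e3 := Md _ kd.
have Kp : K <= K / (1 - s) by rewrite ler_pdivlMr // ler_piMr //; lra.
have Kp0 : 0 <= K / (1 - s) by lra.
have w0 : 0 <= M%:R `^ (- d) :> R by exact: powR_ge0.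
have F1 : K / (1 - s) * (M%:R `^ (2 * (1 - s) - a) + 3 * M%:R `^ (1 - s - a)) <=
   K / (1 - s) * (4 * M%:R `^ (- d)) by apply: ler_wpM2l => //; lra.
have F2 : 2 * K * M%:R `^ (k - s) <= 2 * (K / (1 - s)) * M%:R `^ (- d).
  by rewrite ler_pM ?mulr_ge0 ?powR_ge0 //; lra.
lra.
Qed.

(** Two applications of [controlled_dconv]: the rates are [1 / 2] for a single
    character, [31 / 128] for two and [27 / 256] for three, with growth exponents
    [1 / 64], [1 / 32] and [1 / 16]. *)
Lemma controlled_triple q1 q2 f g s : real_char q1 f -> real_char q2 g ->
  real_char (q1 * q2) (fun n => f n * g n) -> 63 / 64 <= s <= 1 ->
  controlled (wt s (triple f g))
    (Dsum s f * Dsum s g * Dsum s (fun n => f n * g n))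
    (144 * 128 ^+ 3 * (q1 * q2)%:R ^+ 2) (27 / 256) (1 / 16).
Proof.
move=> cf cg cfg /andP[s63 s1].
have ctrl q (h : nat -> R) : real_char q h ->
    controlled (wt s h) (Dsum s h) (128 * q%:R) (1 / 2) (1 / 64).
  move=> ch; have -> : 128 * q%:R = 2 * q%:R / (1 / 64) :> R by field.
  by apply: controlled_real_char => //; lra.
have C2 : controlled (wt s (dconv f g)) (Dsum s f * Dsum s g)
    (12 * (128 * q1%:R) * (128 * q2%:R)) (31 / 128) (1 / 32).
  have -> : 31 / 128 = (1 / 2 - 1 / 64) / 2 :> R by field.
  have -> : 1 / 32 = 2 * (1 / 64) :> R by field.
  apply: eq_controlled (fun n n0 => esym (wt_dconv s f g n0)) _.
  by apply: controlled_dconv; try exact: ctrl; lra.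
have C1 : controlled (wt s (fun n => f n * g n)) (Dsum s (fun n => f n * g n))
    (128 * (q1 * q2)%:R) (31 / 128) (1 / 32).
  by apply: (controlled_weaken (ctrl _ _ cfg)) => //; lra.
apply: eq_controlled (fun n n0 => esym (wt_dconv s _ _ n0)) _.
have := controlled_dconv _ _ _ C2 C1.
have -> : (31 / 128 - 1 / 32) / 2 = 27 / 256 :> R by field.
have -> : 2 * (1 / 32) = 1 / 16 :> R by field.
have -> : 12 * (12 * (128 * q1%:R) * (128 * q2%:R)) * (128 * (q1 * q2)%:R) =
  144 * 128 ^+ 3 * (q1 * q2)%:R ^+ 2 :> R by rewrite natrM; ring.
by apply; lra.
Qed.

End Siegel.

(** * The dichotomy on zeros near 1 *)

Section Family.
Local Open Scope classical_set_scope.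
Context {R : realType}.
Implicit Types (f g : nat -> R) (s p x y : R) (q : nat).

(** [zeta L(f)] at [s = 1 - eta], with error exponent [1 / 16]. *)
Lemma Dsum1_lower_no_zero (eta : R) : 0 < eta -> eta <= 1 / 64 ->
  exists2 c : R, 0 < c & forall q f, real_char q f -> 0 <= Dsum (1 - eta) f ->
    c * q%:R `^ (- (32 * eta)) <= Dsum 1 f.
Proof.
move=> e0 e1.
have eN0 : eta != 0 by rewrite gt_eqF.
have D1 : 1 <= 768 / eta :> R by rewrite ler_pdivlMr //; lra.
have d0 : 0 < 1 / 16 :> R by lra.
have [c c0 Hc] := lower_bound_from_asymptotics D1 d0 e0.
exists c => // q f cf L0; have [q0 hf _ _] := cf.
have -> : 32 * eta = 2 * eta / (1 / 16) by field.
apply: Hc => [|M M0]; first by rewrite ler1n.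
have C s : 1 - 1 / 64 <= s -> s <= 1 ->
    controlled (wt s f) (Dsum s f) (128 * q%:R) (1 / 2) (1 / 64).
  move=> s1 s2; have -> : 128 * q%:R = 2 * q%:R / (1 / 64) :> R by field.
  by apply: controlled_real_char => //; lra.
have s01 : 0 < 1 - eta < 1 by lra.
have Cs : controlled (wt (1 - eta) f) (Dsum (1 - eta) f) (128 * q%:R) (1 / 2) (1 / 64).
  by apply: C; lra.
have C1 : controlled (wt 1 f) (Dsum 1 f) (128 * q%:R) (1 / 2) (1 / 64).
  by apply: C; lra.
have := @rep_lower_bound _ _ _ _ _ _ _ _ (1 / 16) s01
  (fun n => @rep_ge0 _ f n hf) (rep1 hf) L0 Cs C1.
rewrite subKr.
have -> : 768 / eta * q%:R = 6 * (128 * q%:R) / eta by field.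
by apply => //; clear -e0 e1; lra.
Qed.

(** [zeta L(f) L(g) L(f g)] at a zero [s] of [L(f)], with error exponent
    [1 / 16]; the constant depends on [f] and [s] but not on [g]. *)
Lemma Dsum1_lower_zero q1 f s : real_char q1 f -> 63 / 64 <= s < 1 ->
  Dsum s f = 0 ->
  exists2 c : R, 0 < c & forall q2 g, real_char q2 g ->
    real_char (q1 * q2) (fun n => f n * g n) ->
    c * q2%:R `^ (- (64 * (1 - s))) <=
    Dsum 1 f * Dsum 1 g * Dsum 1 (fun n => f n * g n).
Proof.
move=> cf /andP[s63 s1] L0; have [q10 hf _ _] := cf.
have p0 : 0 < 1 - s by lra.
have pN0 : 1 - s != 0 by rewrite gt_eqF.
pose D : R := 6 * (144 * 128 ^+ 3 * q1%:R ^+ 2) / (1 - s).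
have q11 : 1 <= q1%:R ^+ 2 :> R by rewrite exprn_ege1 // ler1n.
have D1 : 1 <= D by rewrite /D ler_pdivlMr //; lra.
have d0 : 0 < 1 / 16 :> R by lra.
have [c c0 Hc] := lower_bound_from_asymptotics D1 d0 p0.
exists c => // q2 g cg cfg; have [q20 hg _ _] := cg.
have -> : q2%:R `^ (- (64 * (1 - s))) =
    (q2%:R ^+ 2) `^ (- (2 * (1 - s) / (1 / 16))) :> R.
  by rewrite -powR_mulrn ?ler0n // -powRrM; congr (_ `^ _); field.
apply: Hc => [|M M0]; first by rewrite exprn_ege1 // ler1n.
have s01 : 0 < s < 1 by lra.
have Cs := controlled_triple cf cg cfg (_ : 63 / 64 <= s <= 1).
have C1 := controlled_triple cf cg cfg (_ : 63 / 64 <= 1 <= 1).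
rewrite L0 !mul0r in Cs.
have := @rep_lower_bound _ _ _ _ _ _ _ _ (1 / 16) s01
  (fun n => @rep_triple_ge0 _ f g n hf hg) (rep_triple1 hf hg) (lexx _)
  (Cs _) (C1 _).
have -> : D * q2%:R ^+ 2 = 6 * (144 * 128 ^+ 3 * (q1 * q2)%:R ^+ 2) / (1 - s).
  by rewrite /D natrM; field.
by apply => //; clear -s63 s1; lra.
Qed.

(** Either no member of the family has a zero close to [1], or one such member
    repels the zeros of all others.  The hypothesis on products says that [f g] is
    nonprincipal: for a principal [f g] the function [L(s, f g)] has a pole at
    [s = 1]. *)
Theorem siegel_family (P : nat -> (nat -> R) -> Prop) (eps : R) : 0 < eps ->
  (forall q f, P q f -> real_char q f) ->
  (forall q1 q2 f g, P q1 f -> P q2 g ->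
     f = g \/ real_char (q1 * q2) (fun n => f n * g n)) ->
  exists2 C : R, 0 < C & forall q f, P q f -> C * q%:R `^ (- eps) < Dsum 1 f.
Proof.
move=> eps0 Pchar Pprod.
(* [64 * eta <= eps / 2] leaves [eps / 2] for the upper bound of [L(1, f g)] *)
pose eta := Num.min (1 / 64) (eps / 128).
have eta0 : 0 < eta by rewrite lt_min; apply/andP; split; lra.
have eta1 : eta <= 1 / 64 by rewrite ge_min lexx.
have eta2 : eta <= eps / 128 by rewrite ge_min lexx orbT.
have weaken (c : R) q e : 0 < c -> (0 < q)%N -> e <= eps ->
    c / 2 * q%:R `^ (- eps) < c * q%:R `^ (- e).
  move=> c0 q0 ee; have qe : 0 < q%:R `^ (- e) :> R by rewrite powR_gt0 ?ltr0n.
  have : q%:R `^ (- eps) <= q%:R `^ (- e) :> R by rewrite ler_powR ?ler1n ?lerN2.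
  by move=> /(ler_wpM2l (ltW c0)); have := mulr_gt0 c0 qe; lra.
have [[q1 [f [s [Pf s1 L0]]]]|nozero] := pselect (exists q1 f s,
    [/\ P q1 f, 1 - eta <= s < 1 & Dsum s f = 0]); last first.
  have [c c0 Hc] := Dsum1_lower_no_zero eta0 eta1.
  exists (c / 2) => [|q f Pf]; first by rewrite divr_gt0.
  have cf := Pchar _ _ Pf; have [q0 _ _ _] := cf.
  apply: lt_le_trans (Hc q f cf _); first by apply: weaken => //; lra.
  rewrite leNgt; apply/negP => Lneg.
  have [|t tI Lt] := Dsum_zero cf (_ : 0 < 1 - eta < 1) Lneg; first by lra.
  by apply: nozero; exists q, f, t.
have cf := Pchar _ _ Pf; have [q10 hf _ _] := cf; have /andP[s2 s3] := s1.
have s63 : 63 / 64 <= s < 1 by lra.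
have [c c0 Hc] := Dsum1_lower_zero cf s63 L0.
pose k := Num.min (1 / 2) (eps / 2).
have k0 : 0 < k by rewrite lt_min; apply/andP; split; lra.
have k1 : k <= 1 / 2 by rewrite ge_min lexx.
have k2 : k <= eps / 2 by rewrite ge_min lexx orbT.
have Lf := Dsum1_gt0 cf.
pose u : R := Dsum 1 f * ((2 + 1 / k) * q1%:R `^ k).
have u0 : 0 < u.
  by rewrite !mulr_gt0 ?powR_gt0 ?ltr0n // addr_gt0 // divr_gt0.
exists (Num.min (c / u / 2) (Dsum 1 f / 2)) => [|q g Pg].
  by rewrite lt_min !divr_gt0.
have cg := Pchar _ _ Pg; have [q0 hg _ _] := cg.
have [fg|cfg] := Pprod _ _ _ _ Pf Pg.
  (* the exceptional character itself *)
  rewrite -fg; apply: (@le_lt_trans _ _ (Dsum 1 f / 2 * q%:R `^ (- eps))).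
    by rewrite ler_wpM2r ?powR_ge0 // ge_min lexx orbT.
  by have := weaken _ q 0 Lf q0 (ltW eps0); rewrite oppr0 powRr0 mulr1.
apply: (@le_lt_trans _ _ (c / u / 2 * q%:R `^ (- eps))).
  by rewrite ler_wpM2r ?powR_ge0 // ge_min lexx.
apply: (@lt_le_trans _ _ (c / u * q%:R `^ (- (64 * (1 - s) + k)))).
  by apply: weaken; rewrite ?divr_gt0 //; lra.
have Lg := Dsum1_gt0 cg; have Lfg := Dsum1_gt0 cfg.
have k01 : 0 < k < 1 by lra.
have := Dsum1_le cfg k01; rewrite (gtr0_norm Lfg) natrM powRM ?ler0n // => U.
have qk : 0 < q%:R `^ k :> R by rewrite powR_gt0 ?ltr0n.
have {}U : Dsum 1 f * Dsum 1 g * Dsum 1 (fun n => f n * g n) <=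
    u * q%:R `^ k * Dsum 1 g.
  have := ler_wpM2l (ltW (mulr_gt0 Lf Lg)) U.
  by move/le_trans; apply; rewrite le_eqVlt /u; apply/orP; left; apply/eqP; ring.
have {}U := le_trans (Hc q g cg cfg) U.
rewrite opprD powRD; last by rewrite pnatr_eq0 -[(q == 0)%N]negbK -lt0n q0 implybT.
rewrite [q%:R `^ (- k)]powRN.
rewrite -(ler_pM2l (mulr_gt0 u0 qk)); apply: le_trans U.
by rewrite le_eqVlt; apply/orP; left; apply/eqP; field; rewrite !gt_eqF.
Qed.
End Family.

(** * Conductors and periods of Dirichlet characters *)

Section DirichletCharacters.
Local Open Scope classical_set_scope.
Context {R : realType}.

Lemma coprimez_mod (m n : int) (d : nat) : (m = n %[mod d])%Z ->
  coprimez m d = coprimez n d.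
Proof.
move/eqP; rewrite eqz_mod_dvd => /dvdzP[k e].
by rewrite !(coprimez_sym _ d) /coprimez -(subrK n m) e gcdzMDl.
Qed.

Section Basics.
Variables (q : nat) (chi : dirichlet_char R q).

Lemma dchar_mod (m n : int) : (m = n %[mod q])%Z -> chi m = chi n.
Proof.
have per (k : nat) x : chi (x + k%:Z * q%:Z) = chi x.
  elim: k => [|k IH]; first by rewrite mul0r addr0.
  by rewrite intS mulrDl mul1r addrCA addrC dchar_periodic.
move/eqP; rewrite eqz_mod_dvd => /dvdzP[[k|k] e].
  by rewrite -(subrK n m) e addrC per.
by rewrite -(subrK m n) -opprB e NegzE mulNr opprK addrC per.
Qed.

Lemma dchar1 : chi 1 = 1.
Proof.
have c1 : chi 1 != 0 by rewrite dchar_supp coprimezE coprime1n.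
by apply: (mulfI c1); rewrite -dcharM mulr1 mulr1.
Qed.

Lemma dchar_eq0 (n : int) : ~~ coprimez n q -> chi n = 0.
Proof. by rewrite -(dchar_supp chi) negbK => /eqP. Qed.

Lemma dchar_inv (n : int) : coprimez n q -> exists u : int,
  [/\ coprimez u q, (u * n = 1 %[mod q])%Z & chi u * chi n = 1].
Proof.
move=> cn; have [u [v e]] := Bezoutz n q.
have e1 : u * n = 1 + - v * q by move: cn e; rewrite /coprimez => /eqP -> <-; ring.
have m1 : (u * n = 1 %[mod q])%Z by rewrite e1 addrC modzMDl.
have chi1 : chi u * chi n = 1 by rewrite -dcharM (dchar_mod m1) dchar1.
exists u; split => //; rewrite -(dchar_supp chi); apply/eqP => u0.
by move/eqP: chi1; rewrite u0 mul0r eq_sym oner_eq0.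
Qed.
End Basics.

(** The factor [k] collects the primes of [q] that do not divide [r]: each prime of
    [q] then divides exactly one of the terms of [r + g * k]. *)
Lemma exists_coprime_lift (g q : nat) (m : int) : (0 < q)%N -> (g %| q)%N ->
  coprimez m g -> exists n : int, coprimez n q /\ (n = m %[mod g])%Z.
Proof.
move=> q0 gq cm; have g0 := dvdn_gt0 q0 gq.
(* [r] has to be positive, as [\pi(0)] is empty *)
have [r [r0 cr er]] : exists r : nat, [/\ (0 < r)%N, coprime r g & (r%:Z = m %[mod g])%Z].
  exists (`|(m %% g)%Z|%N + g)%N.
  have e : ((`|(m %% g)%Z|%N + g)%N%:Z = m %[mod g])%Z.
    by rewrite PoszD gez0_abs ?modz_ge0 ?gt_eqF // modzDr modz_mod.
  split => //; first by rewrite addn_gt0 g0 orbT.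
  by rewrite -[coprime _ _]/(coprimez (_ + g)%N%:Z g) (coprimez_mod e).
pose k := (q`_(\pi(r)^'))%N.
exists (r + g * k)%N%:Z; split; last first.
  by rewrite PoszD PoszM [g%:Z * _]mulrC addrC modzMDl er.
rewrite coprimezE /= coprime_has_primes ?addn_gt0 ?r0 //.
apply/hasPn => p; rewrite !mem_primes q0 addn_gt0 r0 /=.
move=> /andP[pp pq]; rewrite pp /=; apply/negP => pn.
have k0 : (0 < k)%N by rewrite part_gt0.
have pk : (p %| k)%N = ~~ (p %| r)%N.
  have := pi_of_part (\pi(r)^')%N q0 p.
  by rewrite !inE /= !mem_primes pp k0 q0 r0 pq.
have [pr|pr] := boolP (p %| r)%N; last first.
  by rewrite dvdn_addl ?(negbTE pr) // dvdn_mull // pk in pn.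
rewrite dvdn_addr // Euclid_dvdM // pk pr orbF in pn.
have := dvdn_gcd p r g; rewrite pr pn (eqP cr) dvdn1 => /eqP p1.
by rewrite p1 in pp.
Qed.

(** If [chi] is trivial on the residues [1] modulo [d], it factors through the
    residues modulo [g = gcd q d], and primitivity forces [g = q]. *)
Lemma conductor_dvd (q : nat) (chi : dirichlet_char R q) (d : nat) :
  (0 < q)%N -> primitive_dchar chi ->
  (forall n : int, coprimez n q -> (n = 1 %[mod d])%Z -> chi n = 1) -> (q %| d)%N.
Proof.
move=> q0 prim triv; set g := gcdn q d.
have gq : (g %| q)%N by exact: dvdn_gcdl.
have g0 := dvdn_gt0 q0 gq.
(* with [q a + d b = g], subtracting a multiple of [q] moves [1 + g t] into the
   residue [1] modulo [d] *)
have trivg (n : int) : coprimez n q -> (n = 1 %[mod g])%Z -> chi n = 1.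
  move=> cn /eqP; rewrite eqz_mod_dvd => /dvdzP[t e].
  have [a [b ab]] := Bezoutz q d.
  have E : (n - (t * a) * q = 1 + (t * b) * d)%R.
    by rewrite -[n](subrK 1) e -[g%:Z]ab; ring.
  have mq : (n - (t * a) * q = n %[mod q])%Z by rewrite -mulNr addrC modzMDl.
  rewrite -(dchar_mod chi mq); apply: triv; first by rewrite (coprimez_mod mq).
  by rewrite E addrC modzMDl.
have welldef (m n : int) : coprimez m q -> coprimez n q -> (m = n %[mod g])%Z ->
    chi m = chi n.
  move=> cm cn mn; have [u [cu un1 chiu]] := dchar_inv chi cn.
  have um1 : (u * m = 1 %[mod g])%Z.
    rewrite -modzMmr mn modzMmr.
    move/eqP: un1; rewrite eqz_mod_dvd => un1; apply/eqP; rewrite eqz_mod_dvd.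
    exact: dvdz_trans un1.
  have cum : coprimez (u * m) q by rewrite coprimezMl cu.
  have := trivg _ cum um1; rewrite dcharM -chiu => /mulfI; apply.
  by rewrite dchar_supp.
(* the character modulo [g] takes at [m] the value of [chi] at an integer prime
   to [q] in the class of [m] *)
pose lift (m : int) : int :=
  xget 1 [set n : int | coprimez n q /\ (n = m %[mod g])%Z].
have liftP (m : int) : coprimez m g -> coprimez (lift m) q /\ (lift m = m %[mod g])%Z.
  move=> cm; have [n Hn] := exists_coprime_lift q0 gq cm.
  by apply: (@xgetPex _ 1 [set n : int | coprimez n q /\ (n = m %[mod g])%Z]); exists n.
pose psi (m : int) : R[i] := if coprimez m g then chi (lift m) else 0.
have per n : psi (n + g%:Z) = psi n.
  have e : (n + g = n %[mod g])%Z by rewrite modzDr.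
  rewrite /psi (coprimez_mod e); case: ifP => // cn.
  have [A B] := liftP _ cn; rewrite -(coprimez_mod e) in cn.
  have [C D] := liftP _ cn.
  by apply: welldef => //; rewrite B D e.
have mult m n : psi (m * n) = psi m * psi n.
  rewrite /psi coprimezMl.
  case: (boolP (coprimez m g)) => cm; last by rewrite mul0r.
  case: (boolP (coprimez n g)) => cn; last by rewrite mulr0.
  have cmn : coprimez (m * n) g by rewrite coprimezMl cm.
  have [A B] := liftP _ cm; have [C D] := liftP _ cn; have [E F] := liftP _ cmn.
  rewrite -dcharM; apply: welldef => //; first by rewrite coprimezMl A.
  by rewrite F -[RHS]modzMm B D modzMm.
have supp n : (psi n != 0) = coprimez n g.
  rewrite /psi; case: ifP => cn; last by rewrite eqxx.
  by rewrite dchar_supp; case: (liftP _ cn).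
have [gltq|] := ltnP g q; last first.
  by move=> qg; rewrite (_ : q = g) ?dvdn_gcdr //; apply/eqP; rewrite eqn_leq qg dvdn_leq.
exfalso; apply: (prim g (DirichletChar per mult supp) gq gltq) => n cn.
have cng : coprimez n g by apply: coprimez_dvdr cn.
rewrite /= /psi cng; have [A B] := liftP _ cng.
by apply: welldef.
Qed.

Section Quadratic.
Variables (q : nat) (chi : dirichlet_char R q).
Hypothesis quad : quadratic_dchar chi.

Definition re_char (n : nat) : R := complex.Re (chi n%:Z).

Lemma quadratic_val (n : int) : [\/ chi n = -1, chi n = 0 | chi n = 1].
Proof.
have [_ + _] := quad; move=> /(_ n); rewrite /principal_dchar.
have [cn|cn _] := boolP (coprimez n q); last by constructor 2; exact: dchar_eq0.
by move/eqP; rewrite sqrf_eq1 => /orP[] /eqP ->; [constructor 3|constructor 1].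
Qed.

Lemma re_charE n : chi n%:Z = (re_char n)%:C.
Proof.
rewrite /re_char; case: (quadratic_val n%:Z) => -> //=.
by apply/eqP; rewrite eq_complex /= oppr0 !eqxx.
Qed.

Lemma re_char_sign_hom : sign_hom re_char.
Proof.
have inj : injective (fun x : R => x%:C) by move=> x y [].
split=> [|m n|n].
- by rewrite /re_char dchar1.
- by apply: inj; rewrite -re_charE PoszM dcharM !re_charE -rmorphM.
- rewrite /re_char; case: (quadratic_val n%:Z) => ->;
    by [constructor 1|constructor 2|constructor 3].
Qed.

Lemma re_char_per n : re_char (n + q)%N = re_char n.
Proof. by rewrite /re_char PoszD dchar_periodic. Qed.
End Quadratic.

(** Multiplication by [n] permutes the residues modulo [q] and multiplies the sum
    over a period by [f n]. *)
Lemma real_charI (q : nat) (f : nat -> R) (n : nat) : (0 < q)%N -> sign_hom f ->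
  (forall n, f (n + q)%N = f n) -> coprime n q -> f n != 1 -> real_char q f.
Proof.
move=> q0 hf per cn fn; split => //; have [_ fM _] := hf.
have fmod m : f (m %% q)%N = f m.
  rewrite [in RHS](divn_eq m q) addnC.
  elim: (m %/ q)%N => [|k IH]; first by rewrite mul0n addn0.
  by rewrite mulSn addnCA addnC per.
apply/eqP; rewrite big_mkord; set S := \sum_(i < q) _.
suff : (f n - 1) * S == 0 by rewrite mulf_eq0 subr_eq0 (negbTE fn).
rewrite mulrBl mul1r subr_eq0 mulr_sumr; apply/eqP.
pose h (i : 'I_q) : 'I_q := Ordinal (ltn_pmod (n * i) q0).
have hinj : injective h.
  suff le_inj (i j : 'I_q) : (i <= j)%N -> h i = h j -> i = j.
    move=> i j hij; have [ij|/ltnW ji] := leqP i j; first exact: le_inj.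
    by apply/esym/le_inj.
  move=> ij /(congr1 val) /= /esym/eqP; rewrite eqn_mod_dvd ?leq_mul2l ?ij ?orbT //.
  rewrite -mulnBr Gauss_dvdr 1?coprime_sym // => qd; apply: val_inj.
  apply/eqP; rewrite eqn_leq ij /= -subn_eq0; case: posnP => // ji0.
  by move: qd; rewrite gtnNdvd // (leq_ltn_trans (leq_subr i j)).
rewrite /S [RHS](reindex_inj hinj) /=; apply: eq_bigr => i _.
by rewrite fmod fM.
Qed.
End DirichletCharacters.

(** * From Dirichlet characters to real sequences *)

Section Link.
Local Open Scope classical_set_scope.
Context {R : realType}.

Lemma quadratic_real_char (q : nat) (chi : dirichlet_char R q) : (0 < q)%N ->
  quadratic_dchar chi -> real_char q (re_char chi).
Proof.
move=> q0 quad; have [_ _ /(_ 1%N isT)] := quad.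
move=> nprinc; have [n [cn chin]] : exists n : int, coprimez n q /\ chi n != 1.
  apply: contrapT => H; apply: nprinc => n; rewrite expr1 /principal_dchar.
  have [cn|cn] := boolP (coprimez n q); last exact: dchar_eq0.
  by apply/eqP/negPn/negP => c1; apply: H; exists n.
have nq0 : (0 <= n %% q)%Z by rewrite modz_ge0 // gt_eqF.
have e : (`|(n %% q)%Z|%N%:Z = n %[mod q])%Z by rewrite gez0_abs // modz_mod.
apply: (@real_charI _ q _ `|(n %% q)%Z|%N) => //.
- exact: re_char_sign_hom.
- exact: re_char_per.
- by rewrite -[coprime _ _]/(coprimez _%:Z q) (coprimez_mod e).
- apply: contra chin => /eqP f1; rewrite -(dchar_mod chi e) re_charE //.
  by rewrite f1.
Qed.

(** If the product is principal, the two characters agree on the integers prime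
    to both moduli; each is then trivial on the residues [1] modulo the modulus
    of the other, and [conductor_dvd] makes the moduli equal. *)
Lemma re_char_product (q1 q2 : nat) (chi1 : dirichlet_char R q1)
    (chi2 : dirichlet_char R q2) :
  (0 < q1)%N -> (0 < q2)%N -> primitive_dchar chi1 -> primitive_dchar chi2 ->
  quadratic_dchar chi1 -> quadratic_dchar chi2 ->
  re_char chi1 = re_char chi2 \/
  real_char (q1 * q2) (fun n => re_char chi1 n * re_char chi2 n).
Proof.
move=> q10 q20 prim1 prim2 quad1 quad2.
have h1 := re_char_sign_hom quad1; have h2 := re_char_sign_hom quad2.
have qq0 : (0 < q1 * q2)%N by rewrite muln_gt0 q10.
have [[n [cn fn]]|H] := pselect (exists n, coprime n (q1 * q2) /\
    re_char chi1 n * re_char chi2 n != 1).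
  right; apply: (@real_charI _ _ _ n) => //; first exact: sign_homM.
  move=> m; rewrite /re_char PoszD PoszM; congr (complex.Re _ * complex.Re _).
    by apply: dchar_mod; rewrite mulrC addrC modzMDl.
  by apply: dchar_mod; rewrite addrC modzMDl.
left.
have agree_nat n : coprime n (q1 * q2) -> re_char chi1 n = re_char chi2 n.
  move=> cn; have : re_char chi1 n * re_char chi2 n = 1.
    by apply/eqP/negPn/negP => fn; apply: H; exists n.
  have [_ _ /(_ n) v1] := h1; have [_ _ /(_ n) v2] := h2.
  by case: v1 => ->; case: v2 => -> //; lra.
have agree (n : int) : coprimez n (q1 * q2)%N -> chi1 n = chi2 n.
  move=> cn; have nq0 : (0 <= n %% (q1 * q2)%N)%Z by rewrite modz_ge0 // gt_eqF.
  pose m := `|(n %% (q1 * q2)%N)%Z|%N.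
  have e : (m%:Z = n %[mod (q1 * q2)%N])%Z by rewrite gez0_abs // modz_mod.
  have e' (d : nat) : (d %| q1 * q2)%N -> (m%:Z = n %[mod d])%Z.
    move: e => /eqP; rewrite eqz_mod_dvd => e dq; apply/eqP; rewrite eqz_mod_dvd.
    exact: dvdz_trans e.
  rewrite -(dchar_mod chi1 (e' _ (dvdn_mulr _ (dvdnn _)))).
  rewrite -(dchar_mod chi2 (e' _ (dvdn_mull _ (dvdnn _)))).
  rewrite !re_charE // agree_nat //.
  by rewrite -[coprime _ _]/(coprimez m%:Z (q1 * q2)%N) (coprimez_mod e).
have q12 : (q1 %| q2)%N.
  apply: conductor_dvd prim1 _ => // n cn n1.
  have cn2 : coprimez n q2 by rewrite (coprimez_mod n1) coprimezE coprime1n.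
  by rewrite agree ?PoszM ?coprimezMr ?cn // (dchar_mod chi2 n1) dchar1.
have q21 : (q2 %| q1)%N.
  apply: conductor_dvd prim2 _ => // n cn n1.
  have cn2 : coprimez n q1 by rewrite (coprimez_mod n1) coprimezE coprime1n.
  by rewrite -agree ?PoszM ?coprimezMr ?cn ?andbT // (dchar_mod chi1 n1) dchar1.
apply/funext => n; rewrite /re_char.
have eq12 : q1 = q2 by apply/eqP; rewrite eqn_dvd q12.
have [cn|cn] := boolP (coprimez n q1).
  by rewrite agree // PoszM coprimezMr cn -eq12.
by rewrite !dchar_eq0 // -eq12.
Qed.

Lemma cvg_realC (u : nat -> R) (l : R) : u @ \oo --> l ->
  ((fun n => (u n)%:C) : nat -> R[i]^o) @ \oo --> (l%:C : R[i]^o).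
Proof.
move=> ul; apply/cvgrPdist_le => e.
rewrite ltcE /= => /andP[/eqP e0 e1].
move/cvgrPdist_le: ul => /(_ _ e1); apply: filterS => n /= H.
rewrite -rmorphB normc_def /= expr0n addr0 sqrtr_sqr lecE /= e0 eqxx.
exact: H.
Qed.

Lemma nat_cpowN1 (n : nat) : (0 < n)%N -> nat_cpowN n 1 = (n%:R^-1)%:C :> R[i].
Proof.
move=> n0; rewrite /nat_cpowN /cexp mulN1r /= oppr0 cos0 sin0.
rewrite expRN lnK ?posrE ?ltr0n //.
by rewrite -[X in _ * X]/(1 : R[i]) mulr1.
Qed.

Lemma dirichlet_L1 (q : nat) (chi : dirichlet_char R q) : (0 < q)%N ->
  quadratic_dchar chi -> dirichlet_L 1 chi = (Dsum 1 (re_char chi))%:C.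
Proof.
move=> q0 quad; have cf := quadratic_real_char q0 quad.
have [cvg _] := Dsum_real_char cf ltr01.
rewrite /dirichlet_L (_ : (fun N => _) =
    ((fun N => (psum (wt 1 (re_char chi)) N)%:C) : nat -> R[i]^o)).
  exact: cvg_lim (@norm_hausdorff _ R[i]^o) _ _ _ _ _ (cvg_realC cvg).
apply/funext => N; rewrite /psum rmorph_sum /=; apply: eq_big_nat => n /andP[n0 _].
by rewrite nat_cpowN1 // /wt powR_inv1 ?ler0n // rmorphM re_charE.
Qed.
End Link.

Theorem theorem1 (R : realType) (eps : R) (eps_gt0 : 0 < eps) :
  exists2 C : R, 0 < C &
    forall (q : nat) (chi : dirichlet_char R q),
      (1 < q)%N -> primitive_dchar chi -> quadratic_dchar chi ->
      (C * q%:R `^ (- eps))%:C < dirichlet_L 1 chi.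
Proof.
pose P (q : nat) (f : nat -> R) := exists chi : dirichlet_char R q,
  [/\ (0 < q)%N, primitive_dchar chi, quadratic_dchar chi & f = re_char chi].
have [||C C0 HC] := @siegel_family R P eps eps_gt0.
- by move=> q f [chi [q0 _ quad ->]]; exact: quadratic_real_char.
- move=> q1 q2 f g [chi1 [q10 prim1 quad1 ->]] [chi2 [q20 prim2 quad2 ->]].
  exact: re_char_product.
exists C => // q chi q1 prim quad; have q0 := ltnW q1.
by rewrite dirichlet_L1 // ltcR; apply: HC; exists chi.
Qed.
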